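(* Let $H=(V,\mathcal E)$ be a $k$-uniform hypergraph with maximum degree $\Delta$ and let $q$ be a positive integer. Let $B$ be a positive integer and $s=\lfloor (q-1)/B\rfloor$. Suppose that (1) $s^k\ge 608e\,q^2\Delta^3k^5$; (2) $16e^2\Delta^2k^4\cdot q\,(4s/q)^k\le1$; (3) $\lambda\in\mathbb C$ satisfies $|\lambda-\lambda_c|\le\gamma$ for some $\lambda_c\in[0,1]$, where $\gamma=\frac{1}{16\Delta^2k^5}$. Then $Z^{\mathrm{co}}_H(\lambda)\neq0$.
   Context: A hypergraph is $k$-uniform if every hyperedge has exactly $k$ vertices; its maximum degree is the maximum number of hyperedges containing a vertex. A coloring $\sigma\in[q]^V$ is proper if no hyperedge is monochromatic. $Z^{\mathrm{co}}_H(\lambda)=\sum_{\sigma\in[q]^V\text{ proper}}\lambda^{|\{v:\sigma(v)=1\}|}$. *)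

(* Defs.v *)
From mathcomp Require Import all_boot all_order all_algebra.
From mathcomp Require Import complex.
From mathcomp Require Import reals sequences.

Set Implicit Arguments.
Unset Strict Implicit.
Unset Printing Implicit Defensive.

Import Order.TTheory GRing.Theory Num.Theory.

(* A hypergraph on the finite vertex set V is given by its set of hyperedges. *)
Section Hypergraph.
Variables (V : finType) (E : {set {set V}}).

Definition uniform (k : nat) : Prop := forall e : {set V}, e \in E -> #|e| = k.

Definition degree (v : V) : nat := #|[set e in E | v \in e]|.

Definition max_degree : nat := \max_(v : V) degree v.

Section Coloring.
Variable q : nat.
Implicit Type sigma : {ffun V -> 'I_q}.

Definition monochromatic sigma (e : {set V}) : bool :=
  [forall u in e, forall v in e, sigma u == sigma v].

Definition proper_coloring sigma : bool :=
  [forall e in E, ~~ monochromatic sigma e].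

(* The palette {1, ..., q} is represented by 'I_q = {0, ..., q - 1}, so the
   distinguished color 1 is the element of 'I_q of value 0. *)
Definition color1_class sigma : {set V} := [set v | sigma v == 0 :> nat].

Definition Zco (C : comNzRingType) (lambda : C) : C :=
  (\sum_(sigma : {ffun V -> 'I_q} | proper_coloring sigma)
     lambda ^+ #|color1_class sigma|)%R.
End Coloring.
End Hypergraph.

(* Main.v *)
Require Import Defs.
From mathcomp Require Import all_boot all_order all_algebra.
From mathcomp Require Import complex.
From mathcomp Require Import reals sequences.
From mathcomp Require exp.
From mathcomp Require Import ring lra zify.

(** Group the colors other than 1 into [B] buckets of about [s] colors. The weight
    of a bucket assignment [t] is a power of [lambda] times a number of colorings,
    so [lambda] only enters the conditional law of one vertex given the others
    through the isolated color 1. By the local lemma inside the buckets, whatever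
    the other buckets are this law is close to that of an isolated vertex, and it
    differs from it only if a hyperedge at the vertex lies in one bucket elsewhere.

    The normalized weight [mu] is a complex measure. Its total variation grows
    exponentially with the number of vertices, but its marginals obey
    [|mu|(t = p on D) <= prod_{u in D} om (p u) * a ^ |U| * c ^ m] on every set [U]
    containing [D], where [m] counts the hyperedges near [D] whose status is not
    known. Indeed [mu] is invariant under the heat bath at a vertex [v] of [D] (or
    of [U] when [D] is empty). The new conditional law depends on the cluster of
    hyperedges around [v] that lie in one bucket; the cluster is explored by
    revealing hyperedges, each new one being either harmless, at a cost [c], or
    pinned, at a price [sum_x om x ^ k], and [D] has lost [v]. So the update
    contracts the best constant in the bound.

    Non-vanishing follows by restoring the hyperedges vertex by vertex: the
    hyperedges at [v] multiply the partition function by one minus the mean of a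
    function which is small and vanishes unless a hyperedge minus [v] lies in one
    bucket. *)

Set Implicit Arguments.
Unset Strict Implicit.
Unset Printing Implicit Defensive.

Import Order.TTheory GRing.Theory Num.Theory.
Local Open Scope ring_scope.
Local Open Scope complex_scope.

(** * Configurations, constant hyperedges and neighborhoods of vertex sets *)

Section Configurations.
Variables (V X : finType).
Implicit Types (t : {ffun V -> X}) (D U f : {set V}) (Ch E : {set {set V}}).

Definition upd t v x : {ffun V -> X} := [ffun u => if u == v then x else t u].

Definition const_on t f x := [forall u in f, t u == x].

(** Serves two purposes: for a bucket assignment it says that the hyperedge lies in one bucket, for
    a coloring that it is monochromatic. *)
Definition bad t f := [exists x, const_on t f x].

Definition nbr E D := \bigcup_(f in E | ~~ [disjoint f & D]) f.

(** Two steps away rather than one: a conditional law depends on the bad hyperedges meeting [D], and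
    it decouples from the others only once every hyperedge touching those is known to be
    harmless. *)
Definition near E D := [set f in E | ~~ [disjoint f & nbr E D]].

(** Hyperedges through [v] are left out because the value at [v] is being resampled and is never
    among the revealed variables. *)
Definition near_off E v D := [set f in near E (v |: D) | v \notin f].

(** [Ch] collects the hyperedges whose status has been revealed; on this event each of them is
    harmless, being either not bad or attached to [D]. *)
Definition covered D Ch t := [forall f in Ch, bad t f ==> ~~ [disjoint f & D]].

Definition pinned D (p : {ffun V -> X}) t := [forall u in D, t u == p u].

Definition agree U t1 t2 := forall u, u \in U -> t1 u = t2 u.

Definition depends_on (T : Type) U (g : {ffun V -> X} -> T) :=
  forall t1 t2, agree U t1 t2 -> g t1 = g t2.

Lemma upd_id t v : upd t v (t v) = t.
Proof. by apply/ffunP => u; rewrite ffunE; case: eqP => [->|]. Qed.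

Lemma upd_upd t v x y : upd (upd t v x) v y = upd t v y.
Proof. by apply/ffunP => u; rewrite !ffunE; case: eqP. Qed.

Lemma upd_same t v x : upd t v x v = x.
Proof. by rewrite ffunE eqxx. Qed.

Lemma upd_other t v x u : u != v -> upd t v x u = t u.
Proof. by rewrite ffunE => /negPf ->. Qed.

(** Exchanging the old value [t v] with the fresh value [x] is an involution on pairs. This is the
    change of variables behind every resampling argument below. *)
Lemma sum_upd (C : nmodType) v (h : {ffun V -> X} -> X -> C) :
  \sum_t \sum_x h t x = \sum_t \sum_x h (upd t v x) (t v).
Proof.
rewrite !pair_big /=.
rewrite (reindex (fun p : {ffun V -> X} * X => (upd p.1 v p.2, p.1 v))) //=.
by exists (fun p : {ffun V -> X} * X => (upd p.1 v p.2, p.1 v)) => -[t x] _ /=;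
  rewrite upd_upd upd_id upd_same.
Qed.

Lemma agreeS U U' t1 t2 : U \subset U' -> agree U' t1 t2 -> agree U t1 t2.
Proof. by move=> /subsetP UU' a12 u /UU' /a12. Qed.

Lemma const_on_agree f x t1 t2 : agree f t1 t2 -> const_on t1 f x = const_on t2 f x.
Proof. by move=> a12; apply: eq_forallb_in => u /a12 ->. Qed.

Lemma bad_agree f t1 t2 : agree f t1 t2 -> bad t1 f = bad t2 f.
Proof. by move=> a12; apply: eq_existsb => x; apply: const_on_agree. Qed.

Lemma covered_agree D Ch U t1 t2 : (forall f, f \in Ch -> f \subset U) ->
  agree U t1 t2 -> covered D Ch t1 = covered D Ch t2.
Proof.
move=> ChU a12; apply: eq_forallb_in => f /ChU fU.
by rewrite (bad_agree (agreeS fU a12)).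
Qed.

Lemma const_on_uniq f x y t : f != set0 -> const_on t f x -> const_on t f y -> x = y.
Proof.
by case/set0Pn => u uf /forall_inP/(_ _ uf)/eqP <- /forall_inP/(_ _ uf)/eqP <-.
Qed.

Lemma nbrS E D D' : D \subset D' -> nbr E D \subset nbr E D'.
Proof.
move=> DD'; apply/bigcupsP => f /andP[fE fD]; apply: (bigcup_max f) => //.
by rewrite fE; apply: contra fD => /disjointWr -> .
Qed.

Lemma disjointsUr f D D' :
  [disjoint f & D :|: D'] = [disjoint f & D] && [disjoint f & D'].
Proof. by rewrite -!setI_eq0 setIUr setU_eq0. Qed.

Lemma nbrU E D D' : nbr E (D :|: D') = nbr E D :|: nbr E D'.
Proof.
apply/eqP; rewrite eqEsubset subUset !nbrS ?subsetUl ?subsetUr // !andbT.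
apply/bigcupsP => f /andP[fE]; rewrite disjointsUr negb_and => /orP[h|h].
  by apply/subsetU/orP; left; apply: (bigcup_max f); rewrite ?fE.
by apply/subsetU/orP; right; apply: (bigcup_max f); rewrite ?fE.
Qed.

Lemma nearU E D D' : near E (D :|: D') = near E D :|: near E D'.
Proof.
by apply/setP => f; rewrite !inE nbrU disjointsUr negb_and andb_orr.
Qed.

Lemma near_subE E D : near E D \subset E.
Proof. by apply/subsetP => f; rewrite inE => /andP[]. Qed.

Lemma near0 E : near E set0 = set0.
Proof.
have dis0 (g : {set V}) : [disjoint g & set0] by rewrite -setI_eq0 setI0.
apply/setP => f; rewrite !inE /nbr big_pred0 ?dis0 ?andbF // => g.
by rewrite dis0 andbF.
Qed.

Lemma near_sub E E' D : E' \subset E -> near E' D \subset near E D.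
Proof.
move=> sE; apply/subsetP => f; rewrite !inE => /andP[fE fD].
rewrite (subsetP sE) //=; apply: contra fD; apply: disjointWr.
apply/bigcupsP => g /andP[gE gD]; apply: (bigcup_max g) => //.
by rewrite (subsetP sE).
Qed.

(** * Cardinalities of neighborhoods in a uniform hypergraph of bounded degree *)

Section Degrees.
Variables (E : {set {set V}}) (k Delta : nat).
Hypothesis unifE : forall f, f \in E -> #|f| = k.
Hypothesis degE : forall v, (#|[set f in E | v \in f]| <= Delta)%N.

Lemma card_touching D :
  (#|[set f in E | ~~ [disjoint f & D]]| <= Delta * #|D|)%N.
Proof.
have sub : [set f in E | ~~ [disjoint f & D]] \subset
    \bigcup_(u in D) [set f in E | u \in f].
  apply/subsetP => f; rewrite inE => /andP[fE /pred0Pn[u /andP[uf uD]]].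
  by apply/bigcupP; exists u; rewrite ?inE ?fE.
apply: (leq_trans (subset_leq_card sub)).
apply: (@leq_trans (\sum_(u in D) #|[set f in E | u \in f]|)%N).
  elim/big_rec2: _ => [|u m S _ le]; first by rewrite cards0.
  by apply: (leq_trans (leq_card_setU _ _)); rewrite leq_add2l.
rewrite mulnC -sum_nat_const; apply: leq_sum => u _; exact: degE.
Qed.

Lemma card_nbr D : (#|nbr E D| <= k * (Delta * #|D|))%N.
Proof.
apply: (@leq_trans (\sum_(f in [set f in E | ~~ [disjoint f & D]]) k)%N).
  rewrite /nbr (eq_bigl (mem [set f in E | ~~ [disjoint f & D]])); last first.
    by move=> f; rewrite /= inE.
  elim/big_ind2: _ => [|A m B n hA hB|f]; first by rewrite cards0.
    exact: (leq_trans (leq_card_setU _ _) (leq_add hA hB)).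
  by move=> /setIdP[fE _]; rewrite unifE.
by rewrite sum_nat_const mulnC leq_mul2l card_touching orbT.
Qed.

Lemma card_near D : (#|near E D| <= Delta * (k * (Delta * #|D|)))%N.
Proof.
apply: (leq_trans (card_touching _)); rewrite leq_mul2l card_nbr orbT //.
Qed.

Lemma card_near_edge f : f \in E -> (#|near E f| <= Delta ^ 2 * k ^ 2)%N.
Proof.
by move=> fE; apply: (leq_trans (card_near _)); rewrite unifE //; nia.
Qed.

End Degrees.
End Configurations.

(** * The modulus of complex numbers, with values in the real field *)

Section ComplexNorm.
Variable R : rcfType.
Implicit Types x y : R[i].

Lemma normc_ge0 x : 0 <= Normc.normc x.
Proof. by case: x => u v; exact: sqrtr_ge0. Qed.

Lemma ler_normc_sum (I : Type) (r : seq I) (P : pred I) (F : I -> R[i]) :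
  Normc.normc (\sum_(i <- r | P i) F i) <= \sum_(i <- r | P i) Normc.normc (F i).
Proof.
elim/big_rec2: _ => [|i y x _ le]; first by rewrite Normc.normc0.
by apply: (le_trans (le_normcD _ _)); rewrite lerD2l.
Qed.

Lemma normc_real (r : R) : 0 <= r -> Normc.normc r%:C = r.
Proof. by move=> r0; rewrite /= expr0n addr0 sqrtr_sqr ger0_norm. Qed.

Lemma normc_nat n : Normc.normc (n%:R : R[i]) = n%:R.
Proof. by rewrite -[n%:R in LHS](rmorph_nat (real_complex R)) normc_real. Qed.

Lemma ler_normcB x y : Normc.normc (x - y) <= Normc.normc x + Normc.normc y.
Proof. by rewrite -[leRHS](congr1 (+%R _) (normcN y)); exact: le_normcD. Qed.

Lemma ger_normcB x y : Normc.normc x - Normc.normc y <= Normc.normc (x - y).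
Proof. by rewrite lerBlDr -{1}[x](subrK y); exact: le_normcD. Qed.

End ComplexNorm.

(** * Domination of a complex measure and exploration of hyperedges *)

Section Domination.
Variables (R : rcfType) (V X : finType) (E : {set {set V}}) (k Delta : nat).
Variables (om : X -> R) (a c : R).
Implicit Types (t p : {ffun V -> X}) (D U f : {set V}) (Ch : {set {set V}}).
Implicit Types (mu g : {ffun V -> X} -> R[i]).
Local Notation nrm := (@Normc.normc R).

Definition wt D p := \prod_(u in D) om (p u).

(* [phi] is any function of the variables in [U] bounded by the indicator of the
   event, so this bounds the total variation of the marginal of [mu] on [U]
   restricted to that event. *)
Definition dominated mu (M : R) :=
  forall D U Ch p (phi : {ffun V -> X} -> R[i]),
  D \subset U -> (forall f, f \in Ch -> f \subset U) -> depends_on U phi ->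
  (forall t, nrm (phi t) <= (pinned D p t && covered D Ch t)%:R) ->
  nrm (\sum_t mu t * phi t)
    <= M * wt D p * a ^+ #|U| * c ^+ #|near E D :\: Ch|.

(* [h] is determined by the variables in [U'] as soon as the exploration of the
   bad hyperedges around [v] and [D] has stopped inside [U']. *)
Definition local_at (T : Type) v U (h : {ffun V -> X} -> T) := forall D U' Ch,
  U \subset U' -> D \subset U' -> v \notin U' ->
  (forall f, f \in Ch -> f \subset U') -> near_off E v D \subset Ch ->
  forall t1 t2, agree U' t1 t2 -> covered D Ch t1 -> h t1 = h t2.

Hypothesis unifE : forall f, f \in E -> #|f| = k.
Hypothesis degE : forall v, (#|[set f in E | v \in f]| <= Delta)%N.
Hypothesis k_gt0 : (0 < k)%N.
Hypothesis om_gt0 : forall x, 0 < om x.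
Hypothesis a_ge1 : 1 <= a.
Hypothesis c_ge1 : 1 <= c.
Hypothesis step_le :
  a ^+ k * (1 + (\sum_x om x ^+ k) * c ^+ (Delta ^ 2 * k ^ 2)) <= c.

Lemma wt_gt0 D p : 0 < wt D p.
Proof. by apply: prodr_gt0 => u _. Qed.

Lemma local_atS (T : Type) v U U' (g : _ -> T) :
  U \subset U' -> local_at v U g -> local_at v U' g.
Proof. by move=> UU' gl D U1 Ch /(subset_trans UU'); exact: gl. Qed.

Lemma local_atM v U g h :
  local_at v U g -> depends_on U h -> local_at v U (fun t => g t * h t).
Proof.
move=> gl hU D U1 Ch UU1 DU1 vU1 ChU1 nCh t1 t2 a12 cov.
by rewrite (gl D U1 Ch _ _ _ _ _ t1 t2) // (hU t1 t2) //; apply: agreeS a12.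
Qed.

Lemma near_off_edge v D f : f \in near_off E v D -> f \in E /\ v \notin f.
Proof. by rewrite !inE => /andP[/andP[]]. Qed.

Lemma near_offU v D f : near_off E v (f :|: D) \subset near_off E v D :|: near E f.
Proof.
apply/subsetP => h; rewrite in_setU /near_off in_set [h \in [set _ in _ | _]]in_set.
rewrite setUCA nearU in_setU => /andP[/orP[-> _|->->]]; by rewrite ?orbT.
Qed.

(** When the exploration stops, a hyperedge near [D] that is still unrevealed must contain [v]. This
    is the source of the summand [Delta] in the exponents of [c]. *)
Lemma near_setD_le v D Ch : near_off E v D \subset Ch ->
  (#|near E D :\: Ch| <= Delta)%N.
Proof.
move=> sub; apply: leq_trans (degE v); apply/subset_leq_card/subsetP => f.
rewrite in_setD => /andP[fCh fD]; rewrite in_set.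
rewrite (subsetP (near_subE E D)) //=; apply: contraR fCh => vf.
by apply: (subsetP sub); rewrite in_set vf andbT nearU in_setU fD orbT.
Qed.

Lemma dominated_scale mu M D U Ch p g (G : R) :
  dominated mu M -> 0 < G ->
  D \subset U -> (forall f, f \in Ch -> f \subset U) -> depends_on U g ->
  (forall t, nrm (g t) <= G * (pinned D p t && covered D Ch t)%:R) ->
  nrm (\sum_t mu t * g t)
    <= G * (M * wt D p * a ^+ #|U| * c ^+ #|near E D :\: Ch|).
Proof.
move=> dom G0 DU ChU gU gle.
have -> : \sum_t mu t * g t = G%:C * \sum_t mu t * (G^-1%:C * g t).
  rewrite mulr_sumr; apply: eq_bigr => t _.
  rewrite mulrCA [G%:C * _]mulrA -rmorphM divff ?gt_eqF // mul1r //.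
rewrite Normc.normcM (normc_real (ltW G0)) ler_pM2l //.
apply: dom => // [t1 t2 /gU-> //|t].
have Gi0 : 0 <= G^-1 by rewrite invr_ge0 ltW.
by rewrite Normc.normcM (normc_real Gi0) ler_pdivrMl.
Qed.

Lemma wtU_const f x D p : f \in E -> [disjoint f & D] ->
  wt (f :|: D) [ffun u => if u \in f then x else p u] = om x ^+ k * wt D p.
Proof.
move=> fE dis; rewrite /wt (eq_bigl [predU f & D]) => [|u]; last by rewrite !inE.
rewrite bigU //=; congr (_ * _).
  rewrite (eq_bigr (fun=> om x)) ?prodr_const ?unifE // => u uf.
  by rewrite ffunE uf.
apply: eq_bigr => u uD; rewrite ffunE.
by rewrite (disjointFl dis uD).
Qed.

Lemma pinnedU_const f x D p t :
  pinned (f :|: D) [ffun u => if u \in f then x else p u] t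
    = const_on t f x && [forall u in D, (u \notin f) ==> (t u == p u)].
Proof.
apply/forall_inP/andP => [h|[/forall_inP h1 /forall_inP h2] u].
  split; apply/forall_inP => u uf; have := h u; rewrite in_setU uf ?orbT ffunE.
    by rewrite uf => ->.
  by case: (u \in f) => //= ->.
rewrite in_setU ffunE; case: (boolP (u \in f)) => [/h1 //|uf /= uD].
by have := h2 _ uD; rewrite uf.
Qed.

Lemma coveredU1 D Ch f t : covered D (f |: Ch) t
   = (bad t f ==> ~~ [disjoint f & D]) && covered D Ch t.
Proof.
apply/forall_inP/andP => [h|[h1 /forall_inP h2] g].
  split; first by apply: h; rewrite setU11.
  by apply/forall_inP => g gCh; apply: h; rewrite in_setU gCh orbT.
by rewrite in_setU1 => /predU1P[->|/h2].
Qed.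

Lemma coveredS D D' Ch t : D \subset D' -> covered D Ch t -> covered D' Ch t.
Proof.
move=> DD' /forall_inP h; apply/forall_inP => f fCh; apply/implyP => fb.
by move: (implyP (h _ fCh) fb); apply: contra; exact: disjointWr.
Qed.

(* Each new hyperedge [f] near [D] is revealed; either it is bad and disjoint
   from [D], in which case it joins [D], or it is recorded in [Ch]. *)
Lemma explore mu M v : dominated mu M -> 0 <= M ->
  forall D U Ch p g (G : R), v \notin U -> D \subset U ->
  (forall f, f \in Ch -> f \subset U) -> local_at v U g -> 0 < G ->
  (forall t, nrm (g t) <= G * (pinned D p t && covered D Ch t)%:R) ->
  nrm (\sum_t mu t * g t)
    <= G * (M * wt D p * a ^+ #|U| * c ^+ (#|near_off E v D :\: Ch| + Delta)).
Proof.
move=> dom M0 D U Ch p g G; have [n] := ubnP #|E :\: Ch|.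
elim: n => // n IH in D U Ch p g *; rewrite ltnS => En vU DU ChU gl G0 gle.
have a0 : 0 <= a := le_trans ler01 a_ge1.
have c0 : 0 <= c := le_trans ler01 c_ge1.
have [sub|/subsetPn[f fD fCh]] := boolP (near_off E v D \subset Ch).
  apply: (le_trans (dominated_scale dom G0 DU ChU _ gle)).
    (* Locality of [g] is available only on the event [covered]; off that event the assumed bound
       forces [g] to be zero. *)
    move=> t1 t2 a12; case: (boolP (covered D Ch t1)) => [cov|/negPf cov].
      by apply: (gl D U Ch).
    have cov2 : covered D Ch t2 = false by rewrite -(covered_agree _ ChU a12).
    have gz t : covered D Ch t = false -> g t = 0.
      move=> ct; apply/Normc.eq0_normc/eqP; rewrite eq_le normc_ge0 andbT.
      by move: (gle t); rewrite ct andbF mulr0.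
    by rewrite !gz.
  rewrite ler_pM2l // ler_wpM2l ?mulr_ge0 ?exprn_ge0 ?(ltW (wt_gt0 _ _)) //.
  by rewrite ler_weXn2l // (leq_trans (near_setD_le sub)) ?leq_addl.
have [fE vf] := near_off_edge fD.
have fk := unifE fE.
have f0 : f != set0 by rewrite -cards_eq0 fk -lt0n.
have EfCh : (#|E :\: (f |: Ch)| < n)%N.
  apply: leq_trans En; apply: proper_card; rewrite properE setDS ?subsetUr //=.
  by apply/subsetPn; exists f; rewrite ?in_setD ?fE ?fCh // setU11.
have vUf : v \notin U :|: f by rewrite in_setU negb_or vU.
have DUf : D \subset U :|: f by apply: subset_trans (subsetUl _ _).
have ChUf h : h \in f |: Ch -> h \subset U :|: f.
  by rewrite in_setU1 => /predU1P[->|/ChU /subset_trans->]; rewrite ?subsetUr ?subsetUl.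
have nf : (#|near_off E v D :\: (f |: Ch)|.+1 = #|near_off E v D :\: Ch|)%N.
  rewrite (cardsD1 f (_ :\: Ch)) in_setD fCh fD /= add1n; congr _.+1.
  by rewrite setDDl [Ch :|: _]setUC.
have aU : a ^+ #|U :|: f| <= a ^+ #|U| * a ^+ k.
  rewrite -exprD ler_weXn2l // -fk; exact: leq_card_setU.
set m := #|near_off E v D :\: (f |: Ch)| in nf *.
rewrite -nf; set w := wt D p.
have w0 : 0 < w by exact: wt_gt0.
have := step_le; set P := \sum_x om x ^+ k => stepP.
have P0 : 0 <= P by apply: sumr_ge0 => x _; rewrite exprn_ge0 // ltW.
set A := M * w * a ^+ #|U| * a ^+ k * c ^+ (m + Delta).
have A0 : 0 <= A by rewrite /A !mulr_ge0 ?exprn_ge0 // ltW.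
have bnd1 (h : {ffun V -> X} -> R[i]) : local_at v (U :|: f) h ->
    (forall t, nrm (h t) <= G * (pinned D p t && covered D (f |: Ch) t)%:R) ->
    nrm (\sum_t mu t * h t) <= G * A.
  move=> hl hle; apply: (le_trans (IH D (U :|: f) (f |: Ch) p h _ _ _ _ _ _ _)) => //.
  rewrite ler_pM2l // ler_wpM2r ?exprn_ge0 //.
  by rewrite -[leRHS]mulrA ler_wpM2l // mulr_ge0 // ltW.
(* [step_le] balances one revelation: [a ^+ k] for the vertices added to [U], then either a harmless
   hyperedge or one pinned at the price [P], which may bring [Delta ^ 2 * k ^ 2] further hyperedges
   near. The total is one factor [c]. *)
have Ac : A * (1 + P * c ^+ (Delta ^ 2 * k ^ 2))
    <= M * w * a ^+ #|U| * c ^+ (m.+1 + Delta).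
  have reorder (y z u1 u2 : R) : y * z * u1 * u2 = y * u1 * (z * u2) by ring.
  rewrite /A reorder addSn exprSr [leRHS]mulrA ler_wpM2l //.
  by rewrite !mulr_ge0 ?exprn_ge0 // ltW.
have glf : local_at v (U :|: f) g by apply: local_atS gl; exact: subsetUl.
(* A hyperedge meeting [D] is harmless whatever its status, so nothing has to be split. *)
have [dis|ndis] := boolP [disjoint f & D]; last first.
  apply: (le_trans (bnd1 g glf _)) => [t|].
    by rewrite coveredU1 ndis implybT; exact: gle.
  rewrite ler_pM2l //; apply: le_trans Ac.
  by rewrite ler_peMr // lerDl mulr_ge0 ?exprn_ge0.
(* Otherwise [g] is split according to the status of [f]: not bad, or constantly [x] for a value [x]
   that is unique because [f] is nonempty. *)
pose hb t : R[i] := (~~ bad t f)%:R.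
pose hx x t : R[i] := (const_on t f x)%:R.
have split t : g t = g t * hb t + \sum_x g t * hx x t.
  rewrite -mulr_sumr -mulrDr -[LHS]mulr1; congr (_ * _); rewrite /hb /hx.
  case: (boolP (bad t f)) => [/existsP[x tx]|/existsPn h]; last first.
    by rewrite big1 ?addr0 // => x _; rewrite (negPf (h x)).
  rewrite (bigD1 x) //= tx big1 ?addr0 ?add0r // => y yx.
  case: (boolP (const_on t f y)) => // /(const_on_uniq f0 tx) xy.
  by rewrite xy eqxx in yx.
have -> : \sum_t mu t * g t
   = \sum_t mu t * (g t * hb t) + \sum_x \sum_t mu t * (g t * hx x t).
  rewrite exchange_big -big_split /=; apply: eq_bigr => t _.
  by rewrite {1}split mulrDr mulr_sumr.
apply: (le_trans (le_normcD _ _)).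
apply: le_trans (_ : G * (A * (1 + P * c ^+ (Delta ^ 2 * k ^ 2))) <= _); last first.
  by rewrite ler_pM2l.
rewrite mulrDr mulr1 mulrDr lerD //.
  apply: bnd1 => [|t].
    apply: local_atM => // t1 t2 a12; rewrite /hb; congr (~~ _)%:R.
    by apply: bad_agree; apply: agreeS a12; exact: subsetUr.
  rewrite Normc.normcM /hb normc_nat coveredU1.
  case: (bad t f) => /=; last by rewrite mulr1; exact: gle.
  by rewrite mulr0 mulr_ge0 // ltW.
apply: (le_trans (ler_normc_sum _ _ _)).
rewrite /P mulr_suml !mulr_sumr; apply: ler_sum => x _.
pose p' : {ffun V -> X} := [ffun u => if u \in f then x else p u].
apply: (le_trans (IH (f :|: D) (U :|: f) (f |: Ch) p' _ _ vUf _ _ _ _ _)) => //.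
- by rewrite setUC setSU.
- apply: local_atM => // t1 t2 a12; rewrite /hx; congr (_%:R).
  by congr (nat_of_bool _); apply: const_on_agree; apply: agreeS a12; exact: subsetUr.
- move=> t; rewrite Normc.normcM /hx normc_nat pinnedU_const coveredU1.
  case: (const_on t f x) => /=; last by rewrite !mulr0.
  rewrite mulr1 disjointsUr.
  have -> : [disjoint f & f] = false by rewrite -setI_eq0 setIid (negPf f0).
  rewrite implybT /=; apply: (le_trans (gle t)); rewrite ler_pM2l // ler_nat.
  case: (boolP (pinned D p t)) => // /forall_inP pt.
  case: (boolP (covered D Ch t)) => //= cov; rewrite (coveredS _ cov) ?subsetUr //.
  rewrite andbT; case: forall_inP => // h; exfalso; apply: h => u /pt ->.
  by rewrite implybT.
rewrite ler_pM2l // wtU_const //.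
have le1 : M * (om x ^+ k * w) * a ^+ #|U :|: f|
    <= M * (om x ^+ k * w) * (a ^+ #|U| * a ^+ k).
  by rewrite ler_wpM2l // !mulr_ge0 ?exprn_ge0 // ltW.
have le2 : c ^+ (#|near_off E v (f :|: D) :\: (f |: Ch)| + Delta)
    <= c ^+ (m + Delta) * c ^+ (Delta ^ 2 * k ^ 2).
  rewrite -exprD ler_weXn2l // addnAC leq_add2r.
  apply: leq_trans (_ : #|(near_off E v D :\: (f |: Ch)) :|: near E f| <= _)%N.
    apply/subset_leq_card/subsetP => h /setDP[hn hCh].
    apply/setUP; have /setUP[hD|] := subsetP (near_offU v D f) h hn; last by right.
    by left; apply/setDP.
  by apply: (leq_trans (leq_card_setU _ _)); rewrite leq_add2l (card_near_edge unifE).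
apply: (le_trans (ler_pM _ _ le1 le2)).
- by rewrite !mulr_ge0 ?exprn_ge0 // ltW.
- by rewrite exprn_ge0.
rewrite /A le_eqVlt; apply/orP; left; apply/eqP.
have reorder (y z u1 u2 u3 u4 : R) :
  M * (y * z) * (u1 * u2) * (u3 * u4) = M * z * u1 * u2 * u3 * (y * u4) by ring.
by rewrite reorder.
Qed.

End Domination.

(** * Contraction of the domination bound under single-vertex resampling *)

Section HeatBath.
Variables (R : realType) (V X : finType) (E : {set {set V}}) (k Delta : nat).
Variables (om : X -> R) (a c : R).
Implicit Types (t p : {ffun V -> X}) (D U f : {set V}) (Ch : {set {set V}}).
Implicit Types (mu g : {ffun V -> X} -> R[i]).
Local Notation nrm := (@Normc.normc R).

Hypothesis unifE : forall f, f \in E -> #|f| = k.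
Hypothesis degE : forall v, (#|[set f in E | v \in f]| <= Delta)%N.
Hypothesis k_gt0 : (0 < k)%N.
Hypothesis om_gt0 : forall x, 0 < om x.
Hypothesis a_ge1 : 1 <= a.
Hypothesis c_ge1 : 1 <= c.
Hypothesis step_le :
  a ^+ k * (1 + (\sum_x om x ^+ k) * c ^+ (Delta ^ 2 * k ^ 2)) <= c.

Let a0 : 0 <= a. Proof. exact: le_trans ler01 a_ge1. Qed.
Let c0 : 0 <= c. Proof. exact: le_trans ler01 c_ge1. Qed.

Let a_gt0 : 0 < a. Proof. exact: lt_le_trans ltr01 a_ge1. Qed.
Let c_gt0 : 0 < c. Proof. exact: lt_le_trans ltr01 c_ge1. Qed.

Definition blocked v y t e :=
  [&& e \in E, v \in e & const_on t (e :\ v) y].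

Lemma edge_sub_nbr v e : e \in E -> v \in e -> e :\ v \subset nbr E [set v] :\ v.
Proof.
move=> eE ve; apply: setSD; apply: (bigcup_max e) => //; rewrite eE /=.
by apply/pred0Pn; exists v; rewrite /= ve set11.
Qed.

(** Selecting one blocked hyperedge [e] splits [g] into at most [Delta] pieces, each supported where
    [e :\ v] is pinned to [y], an event of weight [om y ^+ k.-1]. The exploration then starts from
    [e :\ v]; since [v] and [e :\ v] make up [e], it faces at most [Delta ^ 2 * k ^ 2]
    hyperedges. *)
Lemma blocked_bound mu M v y U g (G : R) :
  dominated E om a c mu M -> 0 <= M -> v \notin U ->
  nbr E [set v] :\ v \subset U -> local_at E v U g -> 0 <= G ->
  (forall t, nrm (g t) <= G * [exists e, blocked v y t e]%:R) ->
  nrm (\sum_t mu t * g t)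
    <= G * M * a ^+ #|U|
       * (Delta%:R * om y ^+ k.-1 * c ^+ (Delta ^ 2 * k ^ 2 + Delta)).
Proof.
move=> dom M0 vU nU gl; rewrite le_eqVlt => /predU1P[<- gle|G0 gle].
  rewrite big1 ?Normc.normc0 ?mul0r // => t _.
  rewrite [g t]Normc.eq0_normc ?mulr0 //; apply/eqP; rewrite eq_le normc_ge0 andbT.
  by move: (gle t); rewrite mul0r.
pose first t := [pick e | blocked v y t e].
have firstU e : depends_on U (fun t => (first t == Some e)%:R : R[i]).
  move=> t1 t2 a12; congr (nat_of_bool (_ == _))%:R; apply: eq_pick => h.
  rewrite /blocked; case: (boolP (h \in E)) => //= hE.
  case: (boolP (v \in h)) => //= vh; apply: const_on_agree.
  by apply: agreeS a12; apply: subset_trans nU; exact: edge_sub_nbr.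
have gz t : ~~ [exists e, blocked v y t e] -> g t = 0.
  move=> /negPf nb; apply/Normc.eq0_normc/eqP; rewrite eq_le normc_ge0 andbT.
  by move: (gle t); rewrite nb mulr0.
have split t : g t = \sum_(e in [set f in E | v \in f]) g t * (first t == Some e)%:R.
  rewrite /first; case: pickP => [e eb|nb]; last first.
    rewrite gz ?big1 // => [e _|]; rewrite ?mul0r //.
    by apply/existsPn => e; rewrite nb.
  have /and3P[eE ve _] := eb; rewrite (bigD1 e) ?inE ?eE //= eqxx mulr1 big1 ?addr0 //.
  move=> h /andP[_ he]; rewrite (_ : _ == _ = false) ?mulr0 //.
  by apply/eqP => -[eh]; rewrite eh eqxx in he.
have -> : \sum_t mu t * g t = \sum_(e in [set f in E | v \in f])
    \sum_t mu t * (g t * (first t == Some e)%:R).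
  by rewrite exchange_big; apply: eq_bigr => t _; rewrite {1}split mulr_sumr.
apply: (le_trans (ler_normc_sum _ _ _)).
set K := G * (M * om y ^+ k.-1 * a ^+ #|U| * c ^+ (Delta ^ 2 * k ^ 2 + Delta)).
have K0 : 0 <= K by rewrite /K !mulr_ge0 ?exprn_ge0 // ltW.
apply: (@le_trans _ _ (\sum_(e in [set f in E | v \in f]) K)); last first.
  rewrite sumr_const -[leLHS]mulr_natl.
  apply: (@le_trans _ _ (Delta%:R * K)); first by rewrite ler_wpM2r // ler_nat degE.
  rewrite /K le_eqVlt; apply/orP; left; apply/eqP.
  have reorder (z u1 u2 u3 u4 : R) :
    z * (G * (M * u1 * u2 * u3)) = G * M * u2 * (z * u1 * u3) by ring.
  by rewrite reorder.
apply: ler_sum => e; rewrite inE => /andP[eE ve].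
pose p : {ffun V -> X} := [ffun=> y].
have eU : e :\ v \subset U by apply: subset_trans nU; exact: edge_sub_nbr.
have le := @explore R V X E k Delta om a c unifE degE k_gt0 om_gt0 a_ge1 c_ge1 step_le
  mu M v dom M0 (e :\ v) U set0 p (fun t => g t * (first t == Some e)%:R) G vU eU.
apply: (le_trans (le _ _ G0 _)).
- by move=> f; rewrite inE.
- exact: local_atM.
- move=> t; rewrite Normc.normcM normc_nat.
  have -> : covered (e :\ v) set0 t by apply/forall_inP => f; rewrite inE.
  rewrite andbT; case: eqP => [|_]; last first.
    by rewrite mulr0 mulr_ge0 // ltW.
  rewrite /first; case: pickP => // h hb [he]; rewrite he in hb.
  have -> : pinned (e :\ v) p t.
    have /and3P[_ _ /forall_inP et] := hb; apply/forall_inP => u /et.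
    by rewrite ffunE.
  rewrite !mulr1; apply: (le_trans (gle t)).
  by rewrite -[leRHS]mulr1 ler_pM2l // lern1 leq_b1.
rewrite /K ler_pM2l //.
have -> : wt om (e :\ v) p = om y ^+ k.-1.
  rewrite /wt (eq_bigr (fun=> om y)) => [|u _]; last by rewrite ffunE.
  rewrite prodr_const; congr (_ ^+ _).
  by have := cardsD1 v e; rewrite ve unifE // add1n => ->.
rewrite ler_wpM2l ?mulr_ge0 ?exprn_ge0 ?(ltW (om_gt0 _)) // ler_weXn2l // leq_add2r.
apply: leq_trans (card_near_edge unifE degE eE); apply: subset_leq_card.
by rewrite setD0 /near_off setD1K //; apply/subsetP => h; rewrite inE => /andP[].
Qed.

Variables (be : X -> R[i]) (ks : X -> R).
Variable kap : V -> X -> {ffun V -> X} -> R.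

(* [1 - kap v y t] is the ratio by which the hyperedges at [v] reduce the weight
   of the value [y] at [v], given the other values of [t]; [be] is the law of an
   isolated vertex, so [1 - defect v t] normalizes the conditional law at [v]. *)
Definition defect v t := \sum_y be y * (kap v y t)%:C.

Hypothesis kap_ge0 : forall v y t, 0 <= kap v y t.
Hypothesis kap_le : forall v y t, kap v y t <= ks y * [exists e, blocked v y t e]%:R.
Hypothesis kap_upd : forall v y t x, kap v y (upd t v x) = kap v y t.
Hypothesis kap_local : forall v y U, v \notin U ->
  nbr E [set v] :\ v \subset U -> local_at E v U (kap v y).
Hypothesis ks_ge0 : forall y, 0 <= ks y.
Hypothesis ks_le1 : forall y, ks y <= 1.
Hypothesis be_ks : \sum_x nrm (be x) * ks x <= 4^-1.

Lemma kap_ks v y t : kap v y t <= ks y.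
Proof.
apply: (le_trans (kap_le v y t)).
by rewrite -[leRHS]mulr1 ler_wpM2l // lern1 leq_b1.
Qed.

Lemma defect_le v t : nrm (defect v t) <= 4^-1.
Proof.
apply: le_trans be_ks; apply: (le_trans (ler_normc_sum _ _ _)).
apply: ler_sum => y _; rewrite Normc.normcM normc_real // ler_wpM2l ?normc_ge0 //.
exact: kap_ks.
Qed.

Lemma nrm_defect_inv v t : nrm (1 - defect v t)^-1 <= 4 / 3.
Proof.
have h : 3 / 4 <= nrm (1 - defect v t).
  apply: le_trans (ger_normcB _ _); rewrite Normc.normc1.
  by have := defect_le v t; lra.
rewrite Normc.normcV -[4 / 3]invrK lef_pV2 ?posrE; lra.
Qed.

Lemma defect_neq v t : 1 - defect v t != 0.
Proof.
apply: contraTneq isT => h; have := defect_le v t.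
have -> : defect v t = 1 by apply/esym/eqP; rewrite -subr_eq0 h.
by rewrite Normc.normc1; lra.
Qed.

Lemma defect_upd v t x : defect v (upd t v x) = defect v t.
Proof. by apply: eq_bigr => y _; rewrite kap_upd. Qed.

Lemma defect_local v U : v \notin U -> nbr E [set v] :\ v \subset U ->
  local_at E v U (defect v).
Proof.
move=> vU nU D U1 Ch UU1 DU1 vU1 ChU1 nCh t1 t2 a12 cov.
apply: eq_bigr => y _; congr (_ * _%:C).
exact: (kap_local y vU nU UU1 DU1 vU1 ChU1 nCh a12 cov).
Qed.

Variable mu : {ffun V -> X} -> R[i].
Hypothesis stationary : forall v t,
  mu t * (1 - defect v t)
    = be (t v) * (1 - (kap v (t v) t)%:C) * \sum_x mu (upd t v x).

Definition kern v x t := be x * (1 - (kap v x t)%:C) / (1 - defect v t).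

(** After old and new values at [v] are exchanged, [stationary] collapses the sum over the old
    values to [mu t]: the measure is invariant under resampling [v] from [kern]. *)
Lemma heat_bath (phi : {ffun V -> X} -> R[i]) v :
  \sum_t mu t * phi t = \sum_t mu t * \sum_x kern v x t * phi (upd t v x).
Proof.
transitivity (\sum_t \sum_x mu t * (kern v x t * phi (upd t v x))); last first.
  by apply: eq_bigr => t _; rewrite mulr_sumr.
rewrite (sum_upd v); apply: eq_bigr => t _.
transitivity (kern v (t v) t * phi t * \sum_x mu (upd t v x)).
  rewrite mulrAC; congr (_ * _); rewrite /kern mulrAC -stationary.
  by rewrite mulfK // defect_neq.
rewrite mulr_sumr; apply: eq_bigr => x _.
by rewrite upd_upd upd_id /kern kap_upd defect_upd mulrC.
Qed.

Lemma kern_le v x t : nrm (kern v x t) <= 4 / 3 * nrm (be x).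
Proof.
rewrite /kern !Normc.normcM mulrC ler_pM ?mulr_ge0 ?normc_ge0 ?nrm_defect_inv //.
rewrite -[leRHS]mulr1 ler_wpM2l ?normc_ge0 //.
have -> : 1 - (kap v x t)%:C = (1 - kap v x t)%:C :> R[i] by rewrite rmorphB.
rewrite normc_real; have := kap_ks v x t; have := ks_le1 x; have := kap_ge0 v x t; lra.
Qed.

Lemma kern_local v x U : v \notin U -> nbr E [set v] :\ v \subset U ->
  local_at E v U (kern v x).
Proof.
move=> vU nU D U1 Ch UU1 DU1 vU1 ChU1 nCh t1 t2 a12 cov; rewrite /kern.
rewrite (kap_local x vU nU UU1 DU1 vU1 ChU1 nCh a12 cov).
by rewrite (defect_local vU nU UU1 DU1 vU1 ChU1 nCh a12 cov).
Qed.

(** Isolates the law [be], which ignores the rest of the configuration. Each term of the remainder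
    carries a factor [kap v y t], so it vanishes unless some hyperedge at [v] is blocked for [y]. *)
Lemma kern_split v x t : kern v x t
  = be x + \sum_y be y * (kap v y t)%:C * (be x - (x == y)%:R) / (1 - defect v t).
Proof.
apply: (mulIf (defect_neq v t)); rewrite mulrDl mulr_suml.
rewrite (eq_bigr (fun y => be y * (kap v y t)%:C * be x
    - be y * (kap v y t)%:C * (x == y)%:R)) => [|y _]; last first.
  by rewrite mulfVK ?defect_neq // mulrBr.
rewrite sumrB -mulr_suml [X in _ + (_ - X)](bigD1 x) //= eqxx mulr1.
rewrite [X in _ + (_ - (_ + X))]big1.
  rewrite /kern mulfVK ?defect_neq // addr0 /defect; ring.
by move=> y yx; rewrite eq_sym (negPf yx) mulr0.
Qed.

Variables bt th : R.
Hypothesis bt_gt0 : 0 < bt.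
Hypothesis be_le : \sum_x nrm (be x) <= bt.
Hypothesis th_gt0 : 0 < th.
Hypothesis pinned_contraction : forall x,
  4 / 3 * nrm (be x) * (a ^+ (k * Delta) * c ^+ Delta) <= th * om x.
Hypothesis free_contraction :
  bt + a ^+ (k * Delta) * (\sum_y 4 / 3 * (1 + bt) * nrm (be y) * ks y
      * (Delta%:R * om y ^+ k.-1 * c ^+ (Delta ^ 2 * k ^ 2 + Delta))) <= th * a.
Hypothesis mu1 : \sum_t mu t = 1.

(** The variables that matter after resampling [v]: its old value is forgotten, and the hyperedges
    through it are read to compute the new law. *)
Let reveal U v := (U :|: nbr E [set v]) :\ v.

Lemma nbr_reveal U v : nbr E [set v] :\ v \subset reveal U v.
Proof. by rewrite setSD // subsetUr. Qed.

Lemma card_reveal U v : v \in U -> (#|reveal U v| < #|U| + k * Delta)%N.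
Proof.
move=> vU; have := cardsD1 v (U :|: nbr E [set v]).
rewrite in_setU vU add1n /reveal => <-; apply: leq_trans (leq_card_setU _ _) _.
have := card_nbr unifE degE [set v]; rewrite cards1 muln1 => h.
by rewrite leq_add2l.
Qed.

(** Forgetting [v] gains the extra factor [a] on the left; this gain is what makes the step with
    empty [D] contract. *)
Lemma exp_reveal U v : v \in U ->
  a * a ^+ #|reveal U v| <= a ^+ #|U| * a ^+ (k * Delta).
Proof. by move=> vU; rewrite -exprS -exprD ler_weXn2l // card_reveal. Qed.

Lemma upd_depends (T : Type) U v x (phi : {ffun V -> X} -> T) :
  depends_on U phi -> depends_on (reveal U v) (fun t => phi (upd t v x)).
Proof.
move=> phiU t1 t2 a12; apply: phiU => u uU; rewrite !ffunE; case: eqP => // /eqP uv.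
by apply: a12; rewrite !inE uv uU.
Qed.

Lemma covered_upd D Ch v t x : covered D Ch (upd t v x) ->
  covered (D :\ v) [set f in Ch | v \notin f] t.
Proof.
move=> /forall_inP cov; apply/forall_inP => f /setIdP[fCh vf]; apply/implyP => fb.
have agr : agree f t (upd t v x).
  by move=> u uf; rewrite upd_other //; apply: contraNneq vf => <-.
have := implyP (cov _ fCh); rewrite -(bad_agree agr) => /(_ fb).
case/pred0Pn => u /= /andP[uf uD]; apply/pred0Pn; exists u; apply/andP; split=> //=.
by rewrite !inE uD andbT; apply: contraNneq vf => <-.
Qed.

(** Resampling a pinned vertex [v] leaves only the new value [p v], whose kernel is at most
    [4 / 3 * nrm (be x)]. The set [D] loses [v] and its weight [om x], while reading the
    neighborhood costs [a ^+ (k * Delta) * c ^+ Delta]; [pinned_contraction] compares the two. *)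
Lemma pinned_step M D U Ch p (phi : {ffun V -> X} -> R[i]) v :
  dominated E om a c mu M -> 0 <= M -> v \in D ->
  D \subset U -> (forall f, f \in Ch -> f \subset U) -> depends_on U phi ->
  (forall t, nrm (phi t) <= (pinned D p t && covered D Ch t)%:R) ->
  nrm (\sum_t mu t * phi t)
    <= th * (M * wt om D p * a ^+ #|U| * c ^+ #|near E D :\: Ch|).
Proof.
move=> dom M0 vD DU ChU phiU phile; have vU := subsetP DU _ vD.
pose x := p v; pose aa := a ^+ (k * Delta) * c ^+ Delta.
have aa1 : 0 < aa by rewrite mulr_gt0 ?exprn_gt0 ?a_gt0 ?c_gt0.
pose G := th * om x / aa.
have G0 : 0 < G by rewrite /G divr_gt0 // mulr_gt0.
pose g t := kern v x t * phi (upd t v x).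
pose Ch' := [set f in Ch | v \notin f].
rewrite (heat_bath phi v) (eq_bigr (fun t => mu t * g t)) => [|t _]; last first.
  congr (_ * _); rewrite (bigD1 x) //= big1 ?addr0 // => y yx.
  rewrite [phi _]Normc.eq0_normc ?mulr0 //; apply/eqP.
  rewrite eq_le normc_ge0 andbT; apply: (le_trans (phile _)).
  rewrite (_ : pinned _ _ _ = false) //; apply/negP => /forall_inP/(_ _ vD).
  by rewrite upd_same => /eqP yp; rewrite yp eqxx in yx.
have vR : v \notin reveal U v by rewrite !inE eqxx.
apply: (le_trans (explore unifE degE k_gt0 om_gt0 a_ge1 c_ge1 step_le
  (v := v) (D := D :\ v) (U := reveal U v) (Ch := Ch') (p := p) (g := g)
  dom M0 vR _ _ _ G0 _)).
- by rewrite setSD // (subset_trans DU) ?subsetUl.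
- move=> f /setIdP[/ChU fU vf]; rewrite subsetD1 vf andbT.
  by rewrite (subset_trans fU) ?subsetUl.
- apply: local_atM; last exact: upd_depends.
  by apply: kern_local; rewrite ?nbr_reveal.
- move=> t; rewrite /g Normc.normcM ler_pM ?normc_ge0 //.
    by apply: (le_trans (kern_le _ _ _)); rewrite /G ler_pdivlMr.
  apply: (le_trans (phile _)); rewrite ler_nat.
  case: (boolP (pinned D p _)) => // /forall_inP pt.
  case: (boolP (covered D Ch _)) => // /covered_upd -> /=; rewrite andbT.
  rewrite (_ : pinned _ _ _) //; apply/forall_inP => u /setD1P[uv uD].
  by have := pt _ uD; rewrite upd_other.
have wD : wt om D p = om x * wt om (D :\ v) p by rewrite /wt (big_setD1 v).
(* Putting [v] back gives [v |: (D :\ v) = D], so the exploration faces no hyperedge that was not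
   already counted near [D], except for the final [Delta]. *)
have nle : c ^+ (#|near_off E v (D :\ v) :\: Ch'| + Delta)
    <= c ^+ #|near E D :\: Ch| * c ^+ Delta.
  rewrite -exprD ler_weXn2l // leq_add2r; apply/subset_leq_card/subsetP => f.
  rewrite /near_off setD1K // => /setDP[/setIdP[fD vf] fCh].
  by apply/setDP; split=> //; apply: contra fCh => fCh; apply/setIdP.
have ale := exp_reveal vU.
have w0 := wt_gt0 om_gt0 (D :\ v) p.
have aR : a ^+ #|reveal U v| <= a ^+ #|U| * a ^+ (k * Delta).
  by apply: le_trans ale; rewrite ler_peMl ?exprn_ge0.
apply: (@le_trans _ _ (G * (M * wt om (D :\ v) p * (a ^+ #|U| * a ^+ (k * Delta))
    * (c ^+ #|near E D :\: Ch| * c ^+ Delta)))).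
  rewrite ler_pM2l // ler_pM ?mulr_ge0 ?exprn_ge0 ?(ltW w0) //.
  by rewrite ler_wpM2l // mulr_ge0 // ltW.
rewrite le_eqVlt; apply/orP; left; apply/eqP; rewrite wD.
have aan : aa != 0 by rewrite gt_eqF.
have reorder (w u1 u2 u3 u4 : R) : G * (M * w * (u1 * u2) * (u3 * u4))
  = G * (u2 * u4) * (M * w * u1 * u3) by ring.
have reorder' (o w u1 u3 : R) :
  th * o * (M * w * u1 * u3) = th * (M * (o * w) * u1 * u3) by ring.
by rewrite reorder /G divfK // reorder'.
Qed.

(* Nothing is pinned: the law [be] at [v] costs a factor [bt], and the remainder
   of the kernel vanishes unless some hyperedge minus [v] is constant, which then
   becomes pinned. *)
Lemma free_step M U p (phi : {ffun V -> X} -> R[i]) v :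
  dominated E om a c mu M -> 0 <= M -> v \in U -> depends_on U phi ->
  (forall t, nrm (phi t) <= 1) ->
  nrm (\sum_t mu t * phi t) <= th * (M * a ^+ #|U|).
Proof.
move=> dom M0 vU phiU phile.
have vR : v \notin reveal U v by rewrite !inE eqxx.
pose r y t : R[i] := be y * (kap v y t)%:C / (1 - defect v t)
  * \sum_x (be x - (x == y)%:R) * phi (upd t v x).
pose s t : R[i] := \sum_x be x * phi (upd t v x).
have -> : \sum_t mu t * phi t = \sum_t mu t * s t + \sum_y \sum_t mu t * r y t.
  rewrite (heat_bath phi v) exchange_big -big_split; apply: eq_bigr => t _ /=.
  rewrite -mulr_sumr -mulrDr; congr (_ * _); rewrite /s /r.
  under [X in _ + X]eq_bigr do rewrite mulr_sumr.
  rewrite exchange_big -big_split; apply: eq_bigr => x _ /=.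
  rewrite kern_split mulrDl mulr_suml; congr (_ + _); apply: eq_bigr => y _.
  by rewrite mulrA; congr (_ * _); rewrite mulrAC.
apply: (le_trans (le_normcD _ _)).
have sle : nrm (\sum_t mu t * s t) <= bt * (M * a ^+ #|U :\ v|).
  apply: (le_trans (dominated_scale (D := set0) (U := U :\ v) (Ch := set0) (p := p)
    (g := s) dom bt_gt0 _ _ _ _)).
  - exact: sub0set.
  - by move=> f; rewrite inE.
  - move=> t1 t2 a12; apply: eq_bigr => x _; congr (_ * _); apply: phiU => u uU.
    by rewrite !ffunE; case: eqP => // /eqP uv; apply: a12; rewrite !inE uv.
  - move=> t; rewrite (_ : pinned _ _ _ = true); last first.
      by apply/forall_inP => u; rewrite inE.
    rewrite (_ : covered _ _ _ = true); last by apply/forall_inP => u; rewrite inE.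
    rewrite mulr1; apply: (le_trans (ler_normc_sum _ _ _)); apply: le_trans be_le.
    apply: ler_sum => x _; rewrite Normc.normcM -[leRHS]mulr1.
    by rewrite ler_wpM2l ?normc_ge0.
  by rewrite near0 set0D cards0 expr0 mulr1 /wt big_set0 mulr1.
have rle y : nrm (\sum_t mu t * r y t)
    <= 4 / 3 * (1 + bt) * nrm (be y) * ks y * M * a ^+ #|reveal U v|
       * (Delta%:R * om y ^+ k.-1 * c ^+ (Delta ^ 2 * k ^ 2 + Delta)).
  have bt1 : 0 <= 1 + bt by rewrite addr_ge0 // ltW.
  apply: (@blocked_bound mu M v y) => //.
  - exact: nbr_reveal.
  - move=> D U1 Ch UU1 DU1 vU1 ChU1 nCh t1 t2 a12 cov; rewrite /r.
    have nU := nbr_reveal U v.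
    rewrite (kap_local y vR nU UU1 DU1 vU1 ChU1 nCh a12 cov).
    rewrite (defect_local vR nU UU1 DU1 vU1 ChU1 nCh a12 cov); congr (_ * _).
    apply: eq_bigr => x _; congr (_ * _).
    have h : depends_on (reveal U v) (fun t => phi (upd t v x)) by exact: upd_depends.
    by apply: h; exact: agreeS a12.
  - by rewrite !mulr_ge0 ?normc_ge0 ?invr_ge0.
  - move=> t; rewrite /r !Normc.normcM normc_real //.
    have sl : nrm (\sum_x (be x - (x == y)%:R) * phi (upd t v x)) <= 1 + bt.
      apply: (le_trans (ler_normc_sum _ _ _)).
      apply: (@le_trans _ _ (\sum_x (nrm (be x) + (x == y)%:R))).
        apply: ler_sum => x _; rewrite Normc.normcM -[leRHS]mulr1 ler_pM ?normc_ge0 //.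
        by apply: (le_trans (ler_normcB _ _)); rewrite normc_nat.
      rewrite big_split /= addrC lerD // (bigD1 y) //= eqxx big1 ?addr0 //.
      by move=> x /negPf ->.
    apply: (@le_trans _ _ (nrm (be y) * (ks y * [exists e, blocked v y t e]%:R)
        * (4 / 3) * (1 + bt))).
      rewrite ler_pM ?mulr_ge0 ?normc_ge0 // ler_pM ?mulr_ge0 ?normc_ge0 //.
        by rewrite ler_wpM2l ?normc_ge0.
      exact: nrm_defect_inv.
    have reorder (u1 u2 u3 u4 : R) :
      u1 * (u2 * u3) * (4 / 3) * u4 = 4 / 3 * u4 * u1 * u2 * u3 by ring.
    by rewrite reorder.
pose K (y : X) : R := 4 / 3 * (1 + bt) * nrm (be y) * ks y
  * (Delta%:R * om y ^+ k.-1 * c ^+ (Delta ^ 2 * k ^ 2 + Delta)).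
pose S := \sum_y K y.
have contr : bt + a ^+ (k * Delta) * S <= th * a := free_contraction.
have S0 : 0 <= S.
  apply: sumr_ge0 => y _.
  have bt0 := ltW bt_gt0; have omy0 := ltW (om_gt0 y).
  by rewrite /K !mulr_ge0 ?normc_ge0 ?exprn_ge0 ?addr_ge0 ?invr_ge0.
have rsum : nrm (\sum_y \sum_t mu t * r y t) <= S * (M * a ^+ #|reveal U v|).
  apply: (le_trans (ler_normc_sum _ _ _)); rewrite /S mulr_suml.
  apply: ler_sum => y _; apply: (le_trans (rle y)).
  rewrite le_eqVlt; apply/orP; left; apply/eqP.
  have reorder (w u1 u2 : R) : w * M * u1 * u2 = w * u2 * (M * u1) by ring.
  by rewrite reorder.
apply: (le_trans (lerD sle rsum)); rewrite -(ler_pM2l a_gt0).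
have aU : a * a ^+ #|U :\ v| = a ^+ #|U| by rewrite -exprS [in RHS](cardsD1 v) vU.
apply: (@le_trans _ _ (M * a ^+ #|U| * (bt + a ^+ (k * Delta) * S))).
  have reorder (u1 u2 : R) : a * (bt * (M * u1) + S * (M * u2))
    = M * (bt * (a * u1) + S * (a * u2)) by ring.
  have reorder' (u1 u2 : R) :
    M * u1 * (bt + u2 * S) = M * (bt * u1 + S * (u1 * u2)) by ring.
  rewrite reorder reorder' aU ler_wpM2l // lerD2l ler_wpM2l //; exact: exp_reveal.
apply: (@le_trans _ _ (M * a ^+ #|U| * (th * a))).
  by rewrite ler_wpM2l // mulr_ge0 ?exprn_ge0.
have reorder (u1 : R) : M * u1 * (th * a) = a * (th * (M * u1)) by ring.
by rewrite reorder.
Qed.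

(** A vertex of [D] is resampled if there is one, else a vertex of [U]. If both are empty the test
    function is constant and the normalization [mu1] gives the bound 1, hence the maximum. *)
Lemma dominated_step M : dominated E om a c mu M -> 0 <= M ->
  dominated E om a c mu (Num.max 1 (th * M)).
Proof.
move=> dom M0 D U Ch p phi DU ChU phiU phile.
have w0 := wt_gt0 om_gt0 D p.
have max1 : 1 <= Num.max 1 (th * M) by rewrite le_max lexx.
have maxM : th * M <= Num.max 1 (th * M) by rewrite le_max lexx orbT.
have cn n : 1 <= c ^+ n by rewrite exprn_ege1.
have [D0|[v vD]] := set_0Vmem D; last first.
  apply: (le_trans (pinned_step dom M0 vD DU ChU phiU phile)).
  by rewrite !mulrA !ler_wpM2r ?exprn_ge0 // ltW.
have phi1 t : nrm (phi t) <= 1.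
  by apply: (le_trans (phile t)); rewrite lern1 leq_b1.
rewrite D0 /wt big_set0 mulr1; have [U0|[v vU]] := set_0Vmem U; last first.
  apply: (le_trans (free_step p dom M0 vU phiU phi1)).
  rewrite mulrA -[leLHS]mulr1 ler_pM ?mulr_ge0 ?exprn_ge0 ?(ltW th_gt0) //.
  by rewrite ler_wpM2r ?exprn_ge0.
rewrite U0 cards0 expr0 mulr1.
rewrite (eq_bigr (fun t => mu t * phi p)) => [|t _]; last first.
  by congr (_ * _); apply: phiU => u; rewrite U0 inE.
rewrite -mulr_suml mu1 mul1r; apply: (le_trans (phi1 p)).
by rewrite -[leLHS]mulr1 ler_pM.
Qed.

Hypothesis om_le1 : forall x, om x <= 1.

(** The total variation is divided by a lower bound for all weights. As every [om x] is at most 1,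
    the product [o] of them all lies below each, and [wt om D p] is at least [o ^+ #|V|]. *)
Lemma dominated_init : exists2 M : R, 0 <= M & dominated E om a c mu M.
Proof.
pose o := \prod_x om x.
have o0 : 0 < o by apply: prodr_gt0 => x _.
have oo x : o <= om x.
  rewrite /o (bigD1 x) //= -[leRHS]mulr1 ler_wpM2l ?(ltW (om_gt0 _)) //.
  by apply: prodr_ile1 => y _; rewrite om_le1 ltW.
have o1 : o <= 1 by apply: prodr_ile1 => x _; rewrite om_le1 ltW.
pose N := \sum_t nrm (mu t).
have N0 : 0 <= N by apply: sumr_ge0 => t _; exact: normc_ge0.
exists (N / o ^+ #|V|) => [|D U Ch p phi DU ChU phiU phile].
  by rewrite divr_ge0 // exprn_ge0 // ltW.
have wo : o ^+ #|V| <= wt om D p.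
  apply: (@le_trans _ _ (o ^+ #|D|)).
    by apply: ler_wiXn2l; rewrite ?max_card // ltW.
  rewrite -prodr_const; apply: ler_prod => u _; rewrite oo andbT; exact: ltW.
have wo1 : 1 <= (o ^+ #|V|)^-1 * wt om D p.
  by rewrite ler_pdivlMl ?mulr1 // exprn_gt0.
apply: (@le_trans _ _ N).
  apply: (le_trans (ler_normc_sum _ _ _)); apply: ler_sum => t _.
  rewrite Normc.normcM -[leRHS]mulr1 ler_wpM2l ?normc_ge0 //.
  by apply: (le_trans (phile t)); rewrite lern1 leq_b1.
rewrite -!mulrA -[leLHS]mulr1 ler_wpM2l // mulrA -[leLHS]mulr1 ler_pM //.
by rewrite -[leLHS]mulr1 ler_pM // exprn_ege1.
Qed.

Lemma dominatedS M M' : M <= M' ->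
  dominated E om a c mu M -> dominated E om a c mu M'.
Proof.
move=> MM' dom D U Ch p phi DU ChU phiU phile.
apply: (le_trans (dom D U Ch p phi DU ChU phiU phile)).
by rewrite !ler_wpM2r ?exprn_ge0 // ltW // wt_gt0.
Qed.

(* A crude bound holds on a finite space and each heat-bath update contracts it. *)
Lemma dominated1 : th < 1 -> dominated E om a c mu 1.
Proof.
move=> th1; have [M M0 dom] := dominated_init.
have iter n : dominated E om a c mu (Num.max 1 (th ^+ n * M)).
  elim: n => [|n IH].
    by apply: dominatedS dom; rewrite expr0 mul1r le_max lexx orbT.
  apply: dominatedS (dominated_step IH _); last by rewrite le_max ler01.
  rewrite ge_max le_max lexx /= maxr_pMr ?(ltW th_gt0) // mulr1 mulrA -exprS.
  by rewrite ge_max !le_max (ltW th1) lexx orbT.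
(* Bernoulli's inequality for [th^-1 > 1] and the archimedean property provide enough updates to
   absorb [M]. *)
have [n Mn] : exists n, M <= (th^-1) ^+ n.
  pose b := th^-1 - 1.
  have b0 : 0 < b by rewrite subr_gt0 invf_gt1.
  have bern n : n%:R * b <= (th^-1) ^+ n.
    elim: n => [|n IH]; first by rewrite mul0r.
    have X1 : 1 <= (th^-1) ^+ n by rewrite exprn_ege1 // ltW // invf_gt1.
    have -> : (th^-1) ^+ n.+1 = (b + 1) * (th^-1) ^+ n by rewrite /b subrK exprS.
    by rewrite -natr1; nra.
  exists (Num.bound (M / b)); apply: le_trans (bern _).
  by rewrite -ler_pdivrMr // ltW // archi_boundP // divr_ge0 // ltW.
have le1 : th ^+ n * M <= 1.
  by rewrite -ler_pdivlMl ?exprn_gt0 // mulr1 -exprVn.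
by have := iter n; rewrite (max_idPl le1).
Qed.

End HeatBath.

(** * Exchanging parts of two colorings *)

Section Counting.
Variables (V C : finType).
Implicit Types (sg : {ffun V -> C}) (S : {set V}).

Definition mix S sg1 sg2 : {ffun V -> C} :=
  [ffun u => if u \in S then sg1 u else sg2 u].

(** Two colorings that trade their restrictions to [S] also trade the conditions supported on [S],
    while those on the complement stay. The trade is an involution on pairs, so the products of
    counts agree. *)
Lemma card_swap S (A1 A2 R1 R2 : {ffun V -> C} -> bool) :
  depends_on S A1 -> depends_on S A2 ->
  depends_on (~: S) R1 -> depends_on (~: S) R2 ->
  (#|[set sg | A1 sg && R1 sg]| * #|[set sg | A2 sg && R2 sg]|
   = #|[set sg | A2 sg && R1 sg]| * #|[set sg | A1 sg && R2 sg]|)%N.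
Proof.
move=> dA1 dA2 dR1 dR2; rewrite -!cardsX.
pose sw (p : {ffun V -> C} * {ffun V -> C}) := (mix S p.2 p.1, mix S p.1 p.2).
have swK : involutive sw.
  move=> [s1 s2]; rewrite /sw /=; congr (_, _); apply/ffunP => u; rewrite !ffunE;
  by case: (u \in S).
rewrite -[LHS](card_preimset _ (inv_inj swK)); congr #|pred_of_set _|.
apply/setP => -[s1 s2]; rewrite !inE /=.
have onS s s' (P : {ffun V -> C} -> bool) : depends_on S P -> P (mix S s s') = P s.
  by move=> dP; apply: dP => u uS; rewrite ffunE uS.
have offS s s' (P : {ffun V -> C} -> bool) :
    depends_on (~: S) P -> P (mix S s s') = P s'.
  by move=> dP; apply: dP => u; rewrite inE ffunE => /negPf ->.
rewrite !(onS _ _ A1) ?(onS _ _ A2) ?(offS _ _ R1) ?(offS _ _ R2) //.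
by rewrite -!andbA; do ?bool_congr; rewrite andbC -andbA; bool_congr.
Qed.

End Counting.

(** * Elementary inequalities for the local lemma *)

Section Arithmetic.
Variable R : realFieldType.
Implicit Types x y : R.

Lemma half_le_sub x y : x <= y -> y <= 2^-1 -> 2^-1 <= 1 - x.
Proof. by lra. Qed.

Lemma lovasz_arith x n2 n g2 g :
  g <= g2 -> 2 * g2 <= x * n2 -> x * (2^-1 * n2) <= x * n -> g <= x * n.
Proof. by rewrite mulrCA; lra. Qed.

End Arithmetic.

(** * The local lemma for colorings with prescribed buckets *)

Section LocalLemma.
Variables (R : realFieldType) (V C X : finType) (E : {set {set V}}).
Variables (k Delta s : nat) (proj : C -> X) (z : X).
Implicit Types (t : {ffun V -> X}) (sg : {ffun V -> C}) (e f : {set V}).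
Implicit Types (S : {set V}) (G F : {set {set V}}).

Hypothesis unifE : forall f, f \in E -> #|f| = k.
Hypothesis degE : forall v, (#|[set f in E | v \in f]| <= Delta)%N.
Hypothesis k_gt0 : (0 < k)%N.

Definition lifts t sg := [forall u, proj (sg u) == t u].

Definition proper_on G sg := [forall f in G, ~~ bad sg f].

Definition num t (P : {ffun V -> C} -> bool) := #|[set sg | lifts t sg && P sg]|.

Definition fiber x := [set c | proj c == x].

Hypothesis fiber_gt0 : forall x, (0 < #|fiber x|)%N.
Hypothesis fiber_ge : forall x, x != z -> (s <= #|fiber x|)%N.

Lemma card_lifts (P : V -> pred C) :
  #|[set sg : {ffun V -> C} | [forall u, P u (sg u)]]| = (\prod_u #|P u|)%N.
Proof.
transitivity #|family P|; last by rewrite card_family foldrE big_image.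
by apply: eq_card => sg; rewrite inE; apply/forallP/familyP.
Qed.

Lemma num_true t : num t xpredT = (\prod_u #|fiber (t u)|)%N.
Proof.
transitivity (\prod_u #|[pred c | proj c == t u]|)%N; last first.
  by apply: eq_bigr => u _; apply: eq_card => c; rewrite !inE.
by rewrite -card_lifts; apply: eq_card => sg; rewrite !inE andbT.
Qed.

Lemma num_true_gt0 t : (0 < num t xpredT)%N.
Proof. by rewrite num_true prodn_gt0. Qed.

(** In a uniform random lift, a hyperedge lying in bucket [y] is monochromatic with probability
    [#|fiber y|] to the power [1 - #|e|]: one common color is chosen and the vertices outside are
    free. The product form avoids division. *)
Lemma num_const t e y : const_on t e y -> e != set0 ->
  (num t (fun sg => bad sg e) * #|fiber y| ^ #|e|.-1 = num t xpredT)%N.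
Proof.
move=> /forall_inP ty e0.
pose w := (\prod_(u | u \notin e) #|fiber (t u)|)%N.
have total : (num t xpredT = #|fiber y| ^ #|e| * w)%N.
  rewrite num_true (bigID (mem e)) /=; congr (_ * _)%N.
  by rewrite -prod_nat_const; apply: eq_bigr => u /ty/eqP ->.
have one c : c \in fiber y ->
    #|[set sg | lifts t sg && const_on sg e c]| = w.
  rewrite inE => /eqP cy.
  pose P u := [pred d | (proj d == t u) && ((u \in e) ==> (d == c))].
  have -> : [set sg | lifts t sg && const_on sg e c]
      = [set sg : {ffun V -> C} | [forall u, P u (sg u)]].
    apply/setP => sg; rewrite !inE; apply/andP/forallP => [[/forallP h1 /forallP h2] u|h].
      by rewrite /= h1 h2.
    by split; apply/forallP => u; have /andP[] := h u.
  rewrite (card_lifts P) (bigID (mem e)) /= big1 ?mul1n => [|u ue].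
    by apply: eq_bigr => u /negPf ue; apply: eq_card => d; rewrite !inE ue andbT.
  rewrite -(card1 c); apply: eq_card => d; rewrite !inE ue /=.
  by case: (d =P c) => [->|_]; rewrite ?andbF // andbT cy (eqP (ty _ ue)) eqxx.
have /set0Pn[u0 u0e] := e0.
have -> : num t (fun sg => bad sg e) = (#|fiber y| * w)%N.
  rewrite /num -sum1_card (partition_big (fun sg => sg u0) (mem (fiber y))) /=.
    rewrite -sum_nat_const; apply: eq_bigr => c cy; rewrite -(one _ cy) -sum1_card.
    apply: eq_bigl => sg; rewrite !inE -andbA; congr (_ && _).
    apply/andP/idP => [[/existsP[d sd] /eqP <-]|sc].
      by rewrite (eqP (forall_inP sd _ u0e)).
    by split; [apply/existsP; exists c | exact: (forall_inP sc)].
  move=> sg; rewrite !inE => /andP[lt _].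
  by rewrite -(eqP (ty _ u0e)); exact: (forallP lt).
rewrite total mulnAC -expnS prednK //.
by rewrite lt0n cards_eq0.
Qed.

(** The lower bound [s] on the fibers is available only away from [z], so hyperedges constantly in
    [z] have to stay outside the local lemma. *)
Definition noncentral t G := forall f, f \in G -> f \in E /\ ~~ const_on t f z.

(** A hyperedge meeting two buckets is monochromatic in no lift; one lying in a single bucket other
    than [z] is controlled by [num_const] and the size of the fiber. *)
Lemma num_bad_le t e : e \in E -> ~~ const_on t e z ->
  (num t (fun sg => bad sg e) * s ^ k.-1 <= num t xpredT)%N.
Proof.
move=> eE ez; have e0 : e != set0 by rewrite -cards_eq0 unifE // -lt0n.
case: (boolP (bad t e)) => [/existsP[y ty]|tb].
    rewrite -(num_const ty e0) unifE // leq_mul2l.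
  have /fiber_ge sy : y != z by apply: contraNneq ez => <-.
  (* The monotonicity of powers asks for a positive exponent, so [k = 1] is treated apart. *)
  by case: k.-1 => [|n]; rewrite ?expn0 ?orbT // leq_exp2r // sy orbT.
rewrite (_ : num _ _ = 0)%N // /num; apply: eq_card0 => sg; rewrite inE.
apply: contraNF tb => /andP[/forallP lt /existsP[c /forall_inP sc]].
apply/existsP; exists (proj c); apply/forall_inP => u /sc /eqP <-.
by rewrite eq_sym.
Qed.

Definition lifts_on (S : {set V}) t sg := [forall u in S, proj (sg u) == t u].

Lemma lifts_split S t sg : lifts t sg = lifts_on S t sg && lifts_on (~: S) t sg.
Proof.
apply/forallP/andP => [h|[/forall_inP h1 /forall_inP h2] u].
  by split; apply/forall_inP => u _.
by case: (boolP (u \in S)) => uS; [exact: h1 | apply: h2; rewrite inE].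
Qed.

Lemma lifts_on_depends S t : depends_on S (lifts_on S t).
Proof. by move=> s1 s2 a12; apply: eq_forallb_in => u /a12 ->. Qed.

Lemma lifts_on_agree S t1 t2 : agree S t1 t2 -> lifts_on S t1 =1 lifts_on S t2.
Proof. by move=> a12 sg; apply: eq_forallb_in => u /a12 ->. Qed.

Lemma eq_num t P1 P2 : (forall sg, P1 sg = P2 sg) -> num t P1 = num t P2.
Proof. by move=> eP; apply: eq_card => sg; rewrite !inE eP. Qed.

Lemma leq_num t (P1 P2 : {ffun V -> C} -> bool) :
  (forall sg, P1 sg -> P2 sg) -> (num t P1 <= num t P2)%N.
Proof.
move=> sP; apply/subset_leq_card/subsetP => sg; rewrite !inE.
by move=> /andP[-> /sP ->].
Qed.

(** As [t1] and [t2] agree on [S], they impose the same lifting condition there, and the exchange of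
    [card_swap] respects both assignments. *)
Lemma num_swap S t1 t2 (A1 A2 R1 R2 : {ffun V -> C} -> bool) : agree S t1 t2 ->
  depends_on S A1 -> depends_on S A2 ->
  depends_on (~: S) R1 -> depends_on (~: S) R2 ->
  (num t1 (fun sg => A1 sg && R1 sg) * num t2 (fun sg => A2 sg && R2 sg)
   = num t1 (fun sg => A2 sg && R1 sg) * num t2 (fun sg => A1 sg && R2 sg))%N.
Proof.
move=> a12 dA1 dA2 dR1 dR2.
have numE t (A Q : {ffun V -> C} -> bool) : num t (fun sg => A sg && Q sg) =
    #|[set sg | (lifts_on S t sg && A sg) && (lifts_on (~: S) t sg && Q sg)]|.
  by apply: eq_card => sg; rewrite !inE (lifts_split S) andbACA.
have dep T t (A : {ffun V -> C} -> bool) : depends_on T A ->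
    depends_on T (fun sg => lifts_on T t sg && A sg).
  by move=> dA s1 s2 a; rewrite (dA _ _ a) (lifts_on_depends t a).
have numE2 (A Q : {ffun V -> C} -> bool) : num t2 (fun sg => A sg && Q sg) =
    #|[set sg | (lifts_on S t1 sg && A sg) && (lifts_on (~: S) t2 sg && Q sg)]|.
  by rewrite numE; apply: eq_card => sg; rewrite !inE (lifts_on_agree a12).
by rewrite !numE2 !(numE t1); apply: card_swap; exact: dep.
Qed.

Lemma bad_depends (T : finType) f : depends_on f (fun sg : {ffun V -> T} => bad sg f).
Proof. by move=> s1 s2; exact: bad_agree. Qed.

Lemma proper_on_depends S G : (forall f, f \in G -> f \subset S) ->
  depends_on S (proper_on G).
Proof.
move=> GS s1 s2 a12; apply: eq_forallb_in => f /GS fS.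
by rewrite (bad_agree (agreeS fS a12)).
Qed.

Lemma proper_onU F G sg : proper_on (F :|: G) sg = proper_on F sg && proper_on G sg.
Proof.
apply/forall_inP/andP => [h|[/forall_inP h1 /forall_inP h2] f].
  by split; apply/forall_inP => f fG; apply: h; rewrite inE fG ?orbT.
by rewrite inE => /orP[/h1|/h2].
Qed.

Lemma proper_onU1 e G sg : proper_on (e |: G) sg = ~~ bad sg e && proper_on G sg.
Proof.
rewrite proper_onU; congr (_ && _).
apply/forall_inP/idP => [->|eb f]; rewrite ?set11 //.
by rewrite inE => /eqP ->.
Qed.

Let nb t G : R := (num t (proper_on G))%:R.
Let nbad t e G : R := (num t (fun sg => bad sg e && proper_on G sg))%:R.

Lemma num_add_edge t e G : nb t G = nb t (e |: G) + nbad t e G.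
Proof.
rewrite -natrD; congr (_ %:R); rewrite /num.
rewrite -(cardID (fun sg => bad sg e) [set sg | _ & proper_on G sg]) addnC.
congr (_ + _)%N; apply: eq_card => sg; rewrite !inE unfold_in.
  by rewrite proper_onU1; case: (lifts t sg); case: (bad sg e).
by rewrite -andbA [bad _ _ && _]andbC.
Qed.

Variable al : R.
Hypothesis al_def : 2 <= al * (s ^ k.-1)%:R.
Hypothesis al_le : al * (Delta * k)%:R <= 2^-1.
Hypothesis al_ge0 : 0 <= al.
Hypothesis al_lt1 : al < 1.

Let al_le1 : al <= 1. Proof. exact: ltW. Qed.

Lemma bernoulli_sub n : 1 - al * n%:R <= (1 - al) ^+ n.
Proof.
elim: n => [|n IH]; first by rewrite mulr0 subr0.
have X1 : (1 - al) ^+ n <= 1 by apply: exprn_ile1; have := al_ge0; have := al_le1; lra.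
have := al_ge0; rewrite exprS -natr1; nra.
Qed.

(** Hyperedges of [F] are added one at a time, each keeping a fraction at least [1 - al] of the
    proper lifts. The premise is limited to fewer than [n] hyperedges so that it can be the
    induction hypothesis of the local lemma. *)
Lemma num_chain t n : (forall e G, (#|G| < n)%N -> noncentral t (e |: G) ->
    nbad t e G <= al * nb t G) ->
  forall F G, (#|F :|: G| <= n)%N -> noncentral t (F :|: G) ->
  (1 - al) ^+ #|F| * nb t G <= nb t (F :|: G).
Proof.
move=> step F; have [m] := ubnP #|F|; elim: m => // m IH in F *.
rewrite ltnS => Fm G FGn nc.
have [->|[f fF]] := set_0Vmem F; first by rewrite cards0 mul1r set0U.
pose F' := F :\ f; have Fc : #|F| = #|F'|.+1 by rewrite (cardsD1 f) fF.
have FE : F :|: G = f |: (F' :|: G) by rewrite setUA setD1K.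
have sub : F' :|: G \subset F :|: G by rewrite setSU // subsetDl.
have le : (1 - al) ^+ #|F'| * nb t G <= nb t (F' :|: G).
  apply: IH; first by rewrite -Fc.
    exact: leq_trans (subset_leq_card sub) FGn.
  by move=> h /(subsetP sub); exact: nc.
have nb0 : 0 <= nb t (F' :|: G) by exact: ler0n.
rewrite Fc exprS -mulrA; apply: (@le_trans _ _ ((1 - al) * nb t (F' :|: G))).
  by rewrite ler_wpM2l // subr_ge0.
have [fFG|fFG] := boolP (f \in F' :|: G).
  have -> : F :|: G = F' :|: G by rewrite FE; apply/setUidPr; rewrite sub1set.
  by rewrite ler_piMl // gerBl.
have := step f (F' :|: G); rewrite FE in FGn nc *.
have -> : (#|F' :|: G| < n)%N by move: FGn; rewrite cardsU1 fFG.
move=> /(_ isT nc); rewrite (num_add_edge t f (F' :|: G)).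
move: (nb t _) (nbad t f _) => x y h; clear -h.
by rewrite mulrBl mul1r lerBlDr lerD2l.
Qed.

(** Conditions on disjoint vertex sets are independent, which is the exchange of [t] with itself on
    [e]. The factor 2 is the margin put into [al] by [al_def]. *)
Lemma num_bad_avoiding t e G : e \in E -> ~~ const_on t e z ->
  (forall f, f \in G -> [disjoint f & e]) -> 2 * nbad t e G <= al * nb t G.
Proof.
move=> eE ez dis.
have h := @num_swap e t t (fun sg => bad sg e) xpredT (proper_on G) xpredT
  (fun _ _ => erefl) (@bad_depends C e) (fun _ _ _ => erefl) _ (fun _ _ _ => erefl).
have {}h := h (proper_on_depends _).
have dG f : f \in G -> f \subset ~: e by move=> /dis; rewrite disjoints_subset.
have {}h := h dG.
have tr P : num t (fun sg => xpredT sg && P sg) = num t P by apply: eq_num.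
have tr' P : num t (fun sg => P sg && xpredT sg) = num t P.
  by apply: eq_num => sg; rewrite andbT.
rewrite !tr !tr' in h.
have T0 := num_true_gt0 t.
have bl := num_bad_le eE ez.
have le : (num t (fun sg => bad sg e && proper_on G sg) * s ^ k.-1
    <= num t (proper_on G))%N.
  rewrite -(leq_pmul2r T0) mulnAC h -mulnA leq_mul2l bl orbT //.
have leR : nbad t e G * (s ^ k.-1)%:R <= nb t G by rewrite -natrM ler_nat.
have b0 : 0 <= nbad t e G by exact: ler0n.
apply: (@le_trans _ _ (al * (s ^ k.-1)%:R * nbad t e G)).
  by rewrite ler_wpM2r.
by rewrite -mulrA ler_wpM2l // mulrC.
Qed.

(** Induction on the number of hyperedges. Given only [G2], the part of [G] disjoint from [e], the
    event has probability at most [al / 2]. The at most [Delta * k] hyperedges of [G1] meet [e], and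
    restoring them keeps at least half of the lifts, by Bernoulli's inequality and [al_le]. *)
Lemma lovasz t n : forall e G, (#|G| < n)%N -> noncentral t (e |: G) ->
  nbad t e G <= al * nb t G.
Proof.
elim: n => // n IH e G; rewrite ltnS => Gn nc.
have [eE ez] := nc e (setU11 _ _).
pose G1 := [set f in G | ~~ [disjoint f & e]]; pose G2 := G :\: G1.
have GE : G1 :|: G2 = G.
  by apply/setP => f; rewrite !inE; case: (f \in G) => //=; rewrite andbT orbN.
have G1c : (#|G1| <= Delta * k)%N.
  rewrite -(unifE eE); apply: leq_trans (card_touching degE e).
  apply/subset_leq_card/subsetP => f; rewrite !inE => /andP[fG ->]; rewrite andbT.
  by have [] := nc f (setU1r _ fG).
have h1 : nbad t e G <= nbad t e G2.
  rewrite ler_nat; apply: leq_num => sg /andP[-> /=].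
  by rewrite -GE proper_onU => /andP[].
have h2 := @num_bad_avoiding t e G2 eE ez.
have {}h2 : 2 * nbad t e G2 <= al * nb t G2.
  apply: h2 => f /setDP[fG]; rewrite inE fG /= negbK //.
have h3 : (1 - al) ^+ #|G1| * nb t G2 <= nb t G.
  have := @num_chain t n IH G1 G2; rewrite GE; apply=> // f fG.
  by apply: nc; exact: setU1r.
have h4 : 2^-1 <= (1 - al) ^+ #|G1|.
  apply: le_trans (bernoulli_sub _).
  suff : al * #|G1|%:R <= al * (Delta * k)%:R by move/half_le_sub; apply.
  by rewrite ler_wpM2l // ler_nat.
have b0 : 0 <= nb t G2 by exact: ler0n.
have h5 : 2^-1 * nb t G2 <= nb t G by apply: le_trans h3; rewrite ler_wpM2r.
suff : al * (2^-1 * nb t G2) <= al * nb t G by exact: lovasz_arith h1 h2.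
by rewrite ler_wpM2l.
Qed.

Lemma num_ratio t F G : noncentral t (F :|: G) ->
  (1 - al) ^+ #|F| * nb t G <= nb t (F :|: G).
Proof. by move=> nc; apply: (@num_chain t #|F :|: G|) => //; exact: lovasz. Qed.

Definition star v := [set f in E | v \in f].

(** Among the hyperedges not constantly in [z], only these can be monochromatic in a lift of [t]. *)
Definition mono_edges t := [set f in E | ~~ const_on t f z && bad t f].

(* The bucket [z] holds a single color, so a hyperedge constantly in [z] is
   monochromatic; in the other buckets the loss is a ratio of counts. *)
Definition kap v y t : R :=
  if y == z then [exists e, blocked E v z t e]%:R
  else 1 - nb (upd t v y) (mono_edges (upd t v y))
           / nb (upd t v y) (mono_edges (upd t v y) :\: star v).

Definition blocking_rate y : R := if y == z then 1 else Delta%:R * al.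

Lemma noncentral_mono t G : G \subset mono_edges t -> noncentral t G.
Proof. by move=> /subsetP sG f /sG; rewrite inE => /and3P[]. Qed.

Lemma nb_gt0 t G : noncentral t G -> 0 < nb t G.
Proof.
move=> nc; have nc0 : noncentral t (G :|: set0) by rewrite setU0.
have := num_ratio nc0; rewrite setU0; apply: lt_le_trans.
rewrite mulr_gt0 ?exprn_gt0 ?subr_gt0 // ltr0n.
apply: leq_trans (num_true_gt0 t) _; apply: leq_num => sg _.
by apply/forall_inP => f; rewrite inE.
Qed.

Lemma nb_le t F G : F \subset G -> nb t G <= nb t F.
Proof.
move=> /subsetP FG; rewrite ler_nat; apply: leq_num => sg /forall_inP h.
by apply/forall_inP => f /FG; exact: h.
Qed.

Lemma blocked_upd v y t x e : blocked E v y (upd t v x) e = blocked E v y t e.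
Proof.
rewrite /blocked; congr [&& _, _ & _]; apply: const_on_agree => u /setD1P[uv _].
by rewrite upd_other.
Qed.

Lemma star_blocked v y t f : f \in mono_edges (upd t v y) -> v \in f ->
  blocked E v y t f.
Proof.
rewrite inE => /and3P[fE _ /existsP[x fx]] vf; rewrite /blocked fE vf /=.
have := forall_inP fx _ vf; rewrite upd_same => /eqP yx.
apply/forall_inP => u /setD1P[uv uf].
by have := forall_inP fx _ uf; rewrite upd_other // yx.
Qed.

Lemma ratio_le1 v t : nb t (mono_edges t) / nb t (mono_edges t :\: star v) <= 1.
Proof.
rewrite ler_pdivrMr ?mul1r ?nb_le ?subsetDl // nb_gt0 //.
by apply: noncentral_mono; exact: subsetDl.
Qed.

Lemma kap_ge0 v y t : 0 <= kap v y t.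
Proof. by rewrite /kap; case: eqP => // _; rewrite subr_ge0 ratio_le1. Qed.

(** Without a blocked hyperedge, giving [v] the value [y] makes no hyperedge at [v] lie in one
    bucket and the ratio is 1. Otherwise, for [y] other than [z], at most [Delta] hyperedges are
    restored, each losing at most a fraction [al]. *)
Lemma kap_le v y t : kap v y t <= blocking_rate y * [exists e, blocked E v y t e]%:R.
Proof.
rewrite /kap /blocking_rate; case: (y =P z) => [->|_]; first by rewrite mul1r.
set t' := upd t v y; set M := mono_edges t'.
have ncD : noncentral t' (M :\: star v).
  by apply: noncentral_mono; exact: subsetDl.
case: existsP => [_|nbl].
  rewrite mulr1 lerBlDr -lerBlDl ler_pdivlMr ?nb_gt0 //.
  have MU : (M :&: star v) :|: (M :\: star v) = M by exact: setID.
  have := @num_ratio t' (M :&: star v) (M :\: star v); rewrite MU => h.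
  apply: le_trans (h _); last exact: noncentral_mono.
  rewrite ler_wpM2r ?ler0n //; apply: le_trans (bernoulli_sub _).
  rewrite lerD2l lerN2 [leRHS]mulrC ler_wpM2l // ler_nat.
  apply: leq_trans (degE v); apply: subset_leq_card; exact: subsetIr.
have -> : M :\: star v = M.
  apply/setDidPl; rewrite -setI_eq0; apply/eqP/setP => f; rewrite !in_setI in_set0.
  apply/negP => /andP[fM]; rewrite inE => /andP[_ vf]; apply: nbl; exists f.
  exact: star_blocked fM vf.
by rewrite divff ?subrr ?mulr0 // gt_eqF // nb_gt0 //; exact: noncentral_mono.
Qed.

Lemma kap_upd v y t x : kap v y (upd t v x) = kap v y t.
Proof.
rewrite /kap !upd_upd; case: ifP => // _; congr (nat_of_bool _)%:R.
by apply: eq_existsb => e; exact: blocked_upd.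
Qed.

(* The hyperedges that meet [v |: D] are determined by [U'], and no other bad
   hyperedge meets one of them; swapping colorings on their union shows that the
   other bad hyperedges cancel in the ratio. *)
Lemma kap_local v y (U : {set V}) : v \notin U -> nbr E [set v] :\ v \subset U ->
  local_at E v U (kap v y).
Proof.
move=> vU nU D U' Ch UU' DU' vU' ChU' nCh t1 t2 a12 cov.
have nU' := subset_trans nU UU'.
rewrite /kap; case: (y =P z) => [_|_].
  congr (nat_of_bool _)%:R; apply: eq_existsb => e; rewrite /blocked.
  case: (boolP (e \in E)) => //= eE; case: (boolP (v \in e)) => //= ve.
  apply: const_on_agree; apply: agreeS a12; apply: subset_trans nU'.
  exact: edge_sub_nbr.
have fnear f g : f \in E -> v \notin f -> g \in E -> ~~ [disjoint g & v |: D] ->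
    ~~ [disjoint f & g] -> f \in Ch.
  move=> fE vf gE gD fg; apply: (subsetP nCh); rewrite !inE fE vf andbT /=.
  apply: contra fg; apply: disjointWr.
  by apply: (bigcup_max g) => //; rewrite gE.
have near_agree f : f \in E -> ~~ [disjoint f & v |: D] ->
    agree f (upd t1 v y) (upd t2 v y).
  move=> fE fD u uf; rewrite !ffunE; case: eqP => // /eqP uv; apply: a12.
  case: (boolP (v \in f)) => vf.
    by apply: (subsetP nU'); apply: (subsetP (edge_sub_nbr fE vf)); rewrite !inE uv uf.
  apply: (subsetP (ChU' f _)) => //; apply: (fnear f f) => //.
  by rewrite -setI_eq0 setIid; apply/set0Pn; exists u.
pose K t := [set f in mono_edges (upd t v y) | ~~ [disjoint f & v |: D]].
pose Rr t := [set f in mono_edges (upd t v y) | [disjoint f & v |: D]].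
have K12 : K t1 = K t2.
  apply/setP => f; rewrite !inE; case: (boolP (f \in E)) => //= fE.
  case: (boolP [disjoint f & v |: D]) => fD; rewrite ?andbF ?andbT //.
  have a := near_agree f fE fD.
  by rewrite (const_on_agree z a) (bad_agree a).
have KE t : mono_edges (upd t v y) = K t :|: Rr t.
  apply/setP => f.
  by rewrite in_setU [f \in K t]inE [f \in Rr t]inE -andb_orr orNb andbT.
have KDE t : mono_edges (upd t v y) :\: star v = (K t :\: star v) :|: Rr t.
  rewrite KE setDUl; congr (_ :|: _); apply/setDidPl.
  rewrite -setI_eq0; apply/eqP/setP => f; rewrite !in_setI in_set0; apply/negP.
  move=> /andP[/setIdP[_ fD] /setIdP[_ vf]].
  by move/pred0P/(_ v): fD => /=; rewrite vf setU11.
pose S := \bigcup_(f in K t1) f.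
have KS f : f \in K t1 -> f \subset S by move=> fK; exact: (bigcup_max f).
have aS : agree S (upd t1 v y) (upd t2 v y).
  move=> u /bigcupP[f /setIdP[fM fD] uf].
  by apply: (near_agree f) => //; move: fM; rewrite inE => /andP[].
(* A bad hyperedge away from [v |: D] that met [S] would be near it, hence revealed in [Ch];
   [covered] would then make it meet [D]. *)
have RS t f : agree U' t1 t -> f \in Rr t -> f \subset ~: S.
  move=> a1t /setIdP[fM fD]; rewrite -disjoints_subset; apply: contraT => fS.
  have vf : v \notin f.
    by apply: contraL fD => vf; apply/pred0Pn; exists v; rewrite /= vf setU11.
  have /and3P[fE _ fb] : [&& f \in E, ~~ const_on (upd t v y) f z & bad (upd t v y) f].
    by move: fM; rewrite inE.
  have fCh : f \in Ch.
    have /pred0Pn[u /= /andP[uf /bigcupP[g /setIdP[gM gD] ug]]] := fS.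
    have gE : g \in E by move: gM; rewrite inE => /andP[].
    by apply: (fnear f g) => //; apply/pred0Pn; exists u; rewrite /= uf ug.
  have ft : bad t1 f.
    rewrite (bad_agree (agreeS (ChU' f fCh) a1t)) -(bad_agree (t1 := upd t v y)) //.
    by move=> u uf; rewrite upd_other //; apply: contraNneq vf => <-.
  have := implyP (forall_inP cov _ fCh) ft; rewrite (disjointWr _ fD) //.
  exact: subsetUr.
have sw := @num_swap S (upd t1 v y) (upd t2 v y) (proper_on (K t1))
  (proper_on (K t1 :\: star v)) (proper_on (Rr t1)) (proper_on (Rr t2)) aS
  (proper_on_depends KS) _ (proper_on_depends (fun f => RS t1 f (fun _ _ => erefl)))
  (proper_on_depends (fun f => RS t2 f a12)).
have numU t F G : num t (proper_on (F :|: G))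
    = num t (fun sg => proper_on F sg && proper_on G sg).
  by apply: eq_num => sg; exact: proper_onU.
have pos t : 0 < nb (upd t v y) (mono_edges (upd t v y) :\: star v).
  by apply: nb_gt0; apply: noncentral_mono; exact: subsetDl.
have ne t : nb (upd t v y) (mono_edges (upd t v y) :\: star v) != 0.
  by rewrite gt_eqF // pos.
congr (1 - _); apply/eqP; rewrite eqr_div //; apply/eqP.
rewrite /nb -!natrM !KDE !KE -K12 !numU; congr (_%:R).
rewrite sw; first by rewrite mulnC.
by apply: proper_on_depends => f /setDP[/KS].
Qed.

End LocalLemma.

(** * Weights of bucket assignments and the law of an isolated vertex *)

Section Weights.
Variables (R : realType) (V C X : finType) (proj : C -> X) (z : X) (lam : R[i]).
Implicit Types (t : {ffun V -> X}) (sg : {ffun V -> C}) (E : {set {set V}}).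
Hypothesis fiber_gt0 : forall x, (0 < #|fiber proj x|)%N.
Hypothesis fiber_z : #|fiber proj z| = 1%N.

(* Total weight of the proper colorings that [proj] sends to [t]. *)
Definition weight E t : R[i] :=
  lam ^+ #|[set u | t u == z]| * [forall f in E, ~~ const_on t f z]%:R
  * (num proj t (proper_on (mono_edges E z t)))%:R.

(** The unnormalized law of the bucket of an isolated vertex. *)
Definition wcol x : R[i] := (if x == z then lam else 1) * #|fiber proj x|%:R.

Definition wtot : R[i] := \sum_x wcol x.

(** Colorings are grouped by their buckets. A hyperedge constantly in [z] is monochromatic because
    that fiber is a single color, and any other monochromatic hyperedge belongs to [mono_edges]. *)
Lemma weight_sum E : (forall f, f \in E -> f != set0) ->
  \sum_t weight E t
    = \sum_(sg | proper_on E sg) lam ^+ #|[set u | proj (sg u) == z]|.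
Proof.
move=> E0; pose pr (sg : {ffun V -> C}) : {ffun V -> X} := [ffun u => proj (sg u)].
rewrite (partition_big pr xpredT) //=; apply: eq_bigr => t _.
have lE sg : lifts proj t sg = (pr sg == t).
  apply/forallP/eqP => [h|<- u]; last by rewrite ffunE.
  by apply/ffunP => u; rewrite ffunE (eqP (h u)).
have bE sg f : pr sg = t -> f \in E -> bad sg f ->
    const_on t f z || (f \in mono_edges E z t).
  move=> <- fE /existsP[c /forall_inP fc]; rewrite inE fE.
  case: (boolP (const_on _ f z)) => //= _; apply/existsP; exists (proj c).
  by apply/forall_inP => u /fc /eqP <-; rewrite ffunE.
rewrite (eq_bigr (fun=> lam ^+ #|[set u | t u == z]|)) => [|sg /andP[_ /eqP <-]].
  rewrite sumr_const -[RHS]mulr_natr /weight -mulrA; congr (_ * _).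
  case: (boolP [forall f in E, ~~ const_on t f z]) => [/forall_inP nz|]; last first.
    rewrite mul0r negb_forall_in => /exists_inP[f fE]; rewrite negbK => fz.
    rewrite (_ : #|_| = 0)%N //; apply: eq_card0 => sg; rewrite !unfold_in.
    apply/negP => /andP[/forall_inP/(_ _ fE) + /eqP st]; move/negP; apply.
    have /cards1P[c zc] : #|fiber proj z| == 1%N by rewrite fiber_z.
    apply/existsP; exists c; apply/forall_inP => u uf.
    by rewrite -in_set1 -zc inE -(eqP (forall_inP fz _ uf)) -st ffunE.
  rewrite mul1r /num; congr (_%:R); apply: eq_card => sg; rewrite !inE lE andbC.
  rewrite unfold_in; case: eqP => [st|]; rewrite ?andbF // !andbT.
  apply/forall_inP/forall_inP => h f.
    move=> fE; apply/negP => fb; have := bE _ _ st fE fb.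
    by rewrite (negPf (nz f fE)) => /h; rewrite fb.
  by rewrite inE => /andP[/h].
by congr (_ ^+ _); apply: eq_card => u; rewrite !inE ffunE.
Qed.

(** No hyperedge sees [v], so only the power of [lam] and the choice of a color at [v] depend on its
    value; [card_swap] on [[set v]] factors that choice out of the count. *)
Lemma weight_isolated E v t x y : (forall f, f \in E -> v \notin f) ->
  weight E (upd t v x) * wcol y = weight E (upd t v y) * wcol x.
Proof.
move=> Ev.
have agr x' f : f \in E -> agree f (upd t v x') t.
  by move=> fE u uf; rewrite upd_other //; apply: contraNneq (Ev f fE) => <-.
have cz x' : [forall f in E, ~~ const_on (upd t v x') f z]
    = [forall f in E, ~~ const_on t f z].
  by apply: eq_forallb_in => f fE; rewrite (const_on_agree z (agr x' f fE)).
have mz x' : mono_edges E z (upd t v x') = mono_edges E z t.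
  apply/setP => f; rewrite !inE; case: (boolP (f \in E)) => //= fE.
  by rewrite (const_on_agree z (agr x' f fE)) (bad_agree (agr x' f fE)).
have nz x' : #|[set u | upd t v x' u == z]|
    = ((x' == z) + #|[set u | u != v & t u == z]|)%N.
  rewrite (cardsD1 v) inE upd_same; congr (_ + _)%N; apply: eq_card => u.
  by rewrite !inE; case: (boolP (u == v)) => //= uv; rewrite upd_other.
rewrite /weight !cz !mz !nz /wcol.
set P := proper_on _; set b := (_ : bool)%:R.
have PS : depends_on (~: [set v]) P.
  apply: proper_on_depends => f; rewrite inE => /andP[/Ev vf _].
  by rewrite subsetC sub1set inE.
have nE x' : num proj (upd t v x') P
    = #|[set sg : {ffun V -> C} | (proj (sg v) == x')
           && (lifts_on proj (~: [set v]) t sg && P sg)]|.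
  apply: eq_card => sg; rewrite !inE (lifts_split proj [set v]) -andbA; congr (_ && _).
    apply/forall_inP/eqP => [/(_ v)|<- u]; rewrite ?set11 ?inE.
      by rewrite upd_same => /(_ isT)/eqP.
    by move=> /eqP ->; rewrite upd_same.
  congr (_ && _); apply: lifts_on_agree => u; rewrite !inE => uv; exact: upd_other.
have cE x' : #|[set sg : {ffun V -> C} | (proj (sg v) == x') && true]|
    = (#|fiber proj x'| * \prod_(u : V | u != v) #|C|)%N.
  pose Q u := [pred c | (u == v) ==> (proj c == x')].
  have -> : [set sg : {ffun V -> C} | (proj (sg v) == x') && true]
      = [set sg : {ffun V -> C} | [forall u, Q u (sg u)]].
    apply/setP => sg; rewrite !inE andbT; apply/eqP/forallP => [sx u|/(_ v)] /=.
      by apply/implyP => /eqP ->; rewrite sx.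
    by rewrite eqxx => /eqP.
  rewrite (card_lifts Q) (bigD1 v) //=; congr (_ * _)%N.
    by apply: eq_card => c; rewrite !inE eqxx.
  by apply: eq_bigr => u /negPf uv; apply: eq_card => c; rewrite !inE uv.
have := @card_swap V C [set v] (fun sg => proj (sg v) == x) (fun sg => proj (sg v) == y)
  (fun sg => lifts_on proj (~: [set v]) t sg && P sg) xpredT.
rewrite -!nE !cE => sw.
have {}sw : (num proj (upd t v x) P * #|fiber proj y|
    = num proj (upd t v y) P * #|fiber proj x|)%N.
  apply/eqP; rewrite -(@eqn_pmul2r (\prod_(u : V | u != v) #|C|)%N).
    rewrite -!mulnA sw //.
    - by move=> s1 s2 a; rewrite a ?set11.
    - by move=> s1 s2 a; rewrite a ?set11.
    - by move=> s1 s2 a; rewrite (lifts_on_depends proj t a) (PS _ _ a).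
  apply: prodn_gt0 => u; apply: leq_trans (fiber_gt0 z) _; exact: max_card.
have {}sw : (num proj (upd t v x) P)%:R * #|fiber proj y|%:R
    = (num proj (upd t v y) P)%:R * #|fiber proj x|%:R :> R[i] by rewrite -!natrM sw.
set m := #|_|; rewrite !exprD.
have pw x' : lam ^+ (x' == z) = if x' == z then lam else 1.
  by case: (x' == z); rewrite ?expr1 ?expr0.
rewrite !pw; move: (if x == z then _ else _) (if y == z then _ else _) => l1 l2.
have reorder (n1 f1 : R[i]) l l' : l * lam ^+ m * b * n1 * (l' * f1)
  = l * l' * lam ^+ m * b * (n1 * f1) by ring.
by rewrite !reorder sw [l1 * l2]mulrC.
Qed.

Lemma weight_isolated_sum E v t : (forall f, f \in E -> v \notin f) -> wtot != 0 ->
  weight E t = wcol (t v) / wtot * \sum_x weight E (upd t v x).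
Proof.
move=> Ev w0; rewrite mulrAC; apply: (mulIf w0); rewrite divfK // mulr_sumr.
rewrite /wtot mulr_sumr; apply: eq_bigr => x _.
by rewrite -{1}[t](upd_id t v) [RHS]mulrC; exact: weight_isolated.
Qed.

End Weights.

(** * Non-vanishing of the partition function by restoring hyperedges *)

Section Recursion.
Variables (R : realType) (V C X : finType) (proj : C -> X) (z : X) (lam : R[i]).
Variables (k Delta s : nat) (al : R).
Implicit Types (t : {ffun V -> X}) (E : {set {set V}}).
Local Notation nrm := (@Normc.normc R).

Hypothesis k_gt0 : (0 < k)%N.
Hypothesis fiber_gt0 : forall x, (0 < #|fiber proj x|)%N.
Hypothesis fiber_ge : forall x, x != z -> (s <= #|fiber proj x|)%N.
Hypothesis al_def : 2 <= al * (s ^ k.-1)%:R.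
Hypothesis al_le : al * (Delta * k)%:R <= 2^-1.
Hypothesis al_ge0 : 0 <= al.
Hypothesis al_lt1 : al < 1.

Definition uniform_of_degree E := (forall f, f \in E -> #|f| = k) /\
  forall v, (#|[set f in E | v \in f]| <= Delta)%N.

Lemma uniform_of_degreeS E E' : E' \subset E ->
  uniform_of_degree E -> uniform_of_degree E'.
Proof.
move=> /subsetP EE' [un dg]; split=> [f /EE' /un //|v].
apply: leq_trans (dg v); apply/subset_leq_card/subsetP => f.
by rewrite !inE => /andP[/EE' -> ->].
Qed.

(** If [t v] is [z], no hyperedge through [v] is in [mono_edges], and only the condition on
    hyperedges constantly in [z] changes. If not, that condition is unaffected by the hyperedges at
    [v] and only the count of lifts changes. *)
Lemma weight_star E v t : uniform_of_degree E ->
  weight proj z lam E t = weight proj z lam (E :\: star E v) t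
    * (1 - (kap R E proj z v (t v) t)%:C).
Proof.
move=> [un dg]; rewrite /weight -!mulrA; congr (_ * _).
set E' := E :\: star E v; set M := mono_edges E z t.
have ME' : mono_edges E' z t = M :\: star E v.
  by apply/setP => f; rewrite !inE; case: (f \in E); case: (v \in f); rewrite ?andbF.
rewrite ME' /kap upd_id -/M.
have [tz|tz] := eqVneq (t v) z.
  have -> : M :\: star E v = M.
    apply/setDidPl; rewrite -setI_eq0; apply/eqP/setP => f; rewrite !in_setI in_set0.
    apply/negP => /andP[]; rewrite inE => /and3P[fE fz /existsP[x fx]].
    rewrite inE => /andP[_ vf]; case/negP: fz.
    by rewrite -tz (eqP (forall_inP fx _ vf)).
  rewrite mulrCA mulrC; congr (_ * _).
  case: (boolP [exists e, blocked E v z t e]) => [/existsP[e /and3P[eE ve ez]]|nb].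
    rewrite rmorph1 subrr mulr0 (_ : [forall _ in _, _] = false) //; apply/negP.
    move=> /forall_inP/(_ _ eE)/negP; apply; apply/forall_inP => u ue.
    have [->|uv] := eqVneq u v; first by rewrite tz.
    by apply: (forall_inP ez); rewrite !inE uv.
  rewrite rmorph0 subr0 mulr1; congr (nat_of_bool _)%:R.
  apply/forall_inP/forall_inP => h f; first by move=> /setDP[fE _]; exact: h.
  move=> fE; case: (boolP (v \in f)) => vf; last by apply: h; rewrite !inE fE vf.
  apply: contra nb => fz; apply/existsP; exists f; rewrite /blocked fE vf /=.
  by apply/forall_inP => u /setD1P[_ uf]; exact: (forall_inP fz).
have -> : [forall f in E, ~~ const_on t f z] = [forall f in E', ~~ const_on t f z].
  apply/forall_inP/forall_inP => h f; first by move=> /setDP[fE _]; exact: h.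
  move=> fE; case: (boolP (v \in f)) => vf; last by apply: h; rewrite !inE fE vf.
  by apply: contra tz => fz; exact: (forall_inP fz).
congr (_ * _); rewrite rmorphB rmorph1 opprB addrC subrK rmorphM fmorphV !rmorph_nat.
rewrite mulrC divfK // pnatr_eq0 -lt0n.
rewrite -(ltr0n R).
apply: (nb_gt0 un dg k_gt0 fiber_gt0 fiber_ge al_def al_le al_ge0 al_lt1).
by apply: noncentral_mono; exact: subsetDl.
Qed.

Variables (om : X -> R) (a c bt th : R).
Let be x := wcol proj z lam x / wtot proj z lam.
Let ksy := blocking_rate Delta z al.

Hypothesis wtot_neq0 : wtot proj z lam != 0.
Hypothesis om_gt0 : forall x, 0 < om x.
Hypothesis om_le1 : forall x, om x <= 1.
Hypothesis a_ge1 : 1 <= a.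
Hypothesis a_le2 : a <= 2.
Hypothesis c_ge1 : 1 <= c.
Hypothesis step_le :
  a ^+ k * (1 + (\sum_x om x ^+ k) * c ^+ (Delta ^ 2 * k ^ 2)) <= c.
Hypothesis ks_le1 : forall y, ksy y <= 1.
Hypothesis be_ks : \sum_x nrm (be x) * ksy x <= 4^-1.
Hypothesis bt_ge1 : 1 <= bt.
Hypothesis be_le : \sum_x nrm (be x) <= bt.
Hypothesis th_gt0 : 0 < th.
Hypothesis th_lt1 : th < 1.
Hypothesis pinned_contraction : forall x,
  4 / 3 * nrm (be x) * (a ^+ (k * Delta) * c ^+ Delta) <= th * om x.
Hypothesis free_contraction :
  bt + a ^+ (k * Delta) * (\sum_y 4 / 3 * (1 + bt) * nrm (be y) * ksy y
      * (Delta%:R * om y ^+ k.-1 * c ^+ (Delta ^ 2 * k ^ 2 + Delta))) <= th * a.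

Let ks_ge0 y : 0 <= ksy y.
Proof. by rewrite /ksy /blocking_rate; case: ifP => // _; rewrite mulr_ge0. Qed.

Let Z E := \sum_t weight proj z lam E t.

(** Once its hyperedges are removed, [v] follows [be]; restoring them multiplies the weight by
    [1 - kap]. Summing over the values at [v] turns this factor into [1 - defect]. *)
Lemma stationary_weight E v t : uniform_of_degree E ->
  weight proj z lam E t / Z E * (1 - defect be (kap R E proj z) v t)
  = be (t v) * (1 - (kap R E proj z v (t v) t)%:C)
    * \sum_x weight proj z lam E (upd t v x) / Z E.
Proof.
move=> uE; pose E' := E :\: star E v.
have Ev f : f \in E' -> v \notin f.
  by rewrite !inE negb_and => /andP[/orP[/negPf->|//]].
have starE t' := weight_star v t' uE; rewrite -/E' in starE.
pose T := \sum_x weight proj z lam E' (upd t v x).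
have isol t' := weight_isolated_sum fiber_gt0 t' Ev wtot_neq0.
have TE x : \sum_y weight proj z lam E' (upd (upd t v x) v y) = T.
  by apply: eq_bigr => y _; rewrite upd_upd.
rewrite -mulr_suml mulrAC !mulrA; congr (_ * _).
have -> : \sum_x weight proj z lam E (upd t v x)
    = T * (1 - defect be (kap R E proj z) v t).
  rewrite /defect mulrBr mulr1 mulr_sumr /T -sumrB; apply: eq_bigr => x _.
  rewrite starE upd_same kap_upd mulrBr mulr1; congr (_ - _).
  by rewrite isol upd_same TE -/be -/T mulrAC mulrC mulrA.
by rewrite starE isol -/T -/(be (t v)); ring.
Qed.

Lemma dominated_weight E : uniform_of_degree E -> Z E != 0 ->
  dominated E om a c (fun t => weight proj z lam E t / Z E) 1.
Proof.
move=> uE ZE; have [un dg] := uE.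
move=> D U Ch p phi.
apply: (dominated1 un dg k_gt0 om_gt0 a_ge1 c_ge1 step_le (be := be) (ks := ksy)
  (kap := kap R E proj z) _ _ _ _ ks_ge0 ks_le1 be_ks _ (bt := bt) (th := th) _
  be_le th_gt0 pinned_contraction free_contraction _ om_le1 th_lt1).
- move=> v y t; exact: (kap_ge0 un dg k_gt0 fiber_gt0 fiber_ge al_def al_le).
- move=> v y t; exact: (kap_le un dg k_gt0 fiber_gt0 fiber_ge al_def al_le).
- by move=> v y t x; exact: kap_upd.
- move=> v y U1 vU nU.
  exact: (kap_local un dg k_gt0 fiber_gt0 fiber_ge al_def al_le).
- by move=> v t; exact: stationary_weight.
- exact: lt_le_trans ltr01 bt_ge1.
- by rewrite -mulr_suml divff.
Qed.

Lemma weight_sum0 : Z set0 = wtot proj z lam ^+ #|V|.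
Proof.
have wE t : weight proj z lam set0 t = \prod_u wcol proj z lam (t u).
  rewrite /weight (_ : [forall f in _, _] = true) ?mulr1; last first.
    by apply/forall_inP => f; rewrite inE.
  have -> : num proj t (proper_on (mono_edges set0 z t)) = num proj t xpredT.
    by apply: eq_num => sg; apply/forall_inP => f; rewrite !inE.
  rewrite num_true natr_prod big_split /=; congr (_ * _).
  by rewrite -big_mkcond prodr_const cardsE.
rewrite /Z (eq_bigr _ (fun t _ => wE t)) -(bigA_distr_bigA (fun=> wcol proj z lam)).
by rewrite prodr_const.
Qed.

(* Adding the hyperedges at [v] multiplies the sum by one minus the mean of [kap],
   which the bound for the smaller hypergraph makes small. *)
Lemma weight_sum_neq0 E : uniform_of_degree E -> Z E != 0.
Proof.
have [n] := ubnP #|E|; elim: n => // n IH in E *; rewrite ltnS => En uE.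
have [E0|[e eE]] := set_0Vmem E.
  by rewrite E0 weight_sum0 expf_neq0.
have [un dg] := uE.
have /set0Pn[v ve] : e != set0 by rewrite -cards_eq0 un // -lt0n.
pose E' := E :\: star E v.
have E'E : E' \subset E by exact: subsetDl.
have uE' := uniform_of_degreeS E'E uE.
have ZE' : Z E' != 0.
  apply: IH uE'; apply: leq_trans En; apply: proper_card; rewrite properE E'E /=.
  by apply/subsetPn; exists e; rewrite // !inE eE ve.
pose mu t := weight proj z lam E' t / Z E'.
(* The bound for [E'] is restated with the neighborhoods of [E], to which the locality of [kap]
   refers; this only enlarges the exponent of [c]. *)
have dom : dominated E om a c mu 1.
  move=> D U Ch p phi DU ChU phiU phile.
  apply: (le_trans (dominated_weight uE' ZE' DU ChU phiU phile)).
  rewrite ler_wpM2l //.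
    by rewrite mul1r mulr_ge0 ?exprn_ge0 ?(le_trans ler01 a_ge1) // ltW // wt_gt0.
  by rewrite ler_weXn2l // subset_leq_card // setSD // near_sub.
pose T y := \sum_t mu t * (kap R E proj z v y t)%:C.
have ZEE : Z E = Z E' * (1 - \sum_y be y * T y).
  (* [kap] ignores the value at [v], and [v] is isolated in [E'], so that value may be redrawn from
     [be]. *)
  have -> : \sum_y be y * T y = \sum_t mu t * (kap R E proj z v (t v) t)%:C.
    transitivity (\sum_t \sum_x be x * (mu t * (kap R E proj z v x t)%:C)).
      by rewrite exchange_big; apply: eq_bigr => y _; rewrite mulr_sumr.
    rewrite (sum_upd v); apply: eq_bigr => t _.
    under eq_bigr do rewrite kap_upd mulrA.
    rewrite -mulr_suml -mulr_sumr; congr (_ * _).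
    rewrite /mu -mulr_suml mulrA; congr (_ / _); apply/esym.
    apply: weight_isolated_sum => // f.
    by rewrite !inE negb_and => /andP[/orP[/negPf->|//]].
  rewrite mulrBr mulr1 mulr_sumr -sumrB; apply: eq_bigr => t _.
  rewrite (weight_star v t uE) -/E' mulrBr mulr1 /mu; congr (_ - _).
  by rewrite mulrA mulrCA divff // mulr1.
rewrite ZEE mulf_neq0 //; apply: contraTneq isT => /eqP; rewrite subr_eq0 => /eqP T1.
pose K y := Delta%:R * om y ^+ k.-1 * c ^+ (Delta ^ 2 * k ^ 2 + Delta).
have K0 y : 0 <= K y.
  by rewrite !mulr_ge0 ?exprn_ge0 ?(le_trans ler01 c_ge1) // ltW.
have a0 := le_trans ler01 a_ge1.
have Tle y : nrm (T y) <= ksy y * (a ^+ (k * Delta) * K y).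
  pose U := nbr E [set v] :\ v.
  have vU : v \notin U by rewrite !inE eqxx.
  have kl : local_at E v U (fun t => (kap R E proj z v y t)%:C).
    move=> D U1 Ch h1 h2 h3 h4 h5 t1 t2 h6 h7; congr (_%:C).
    exact: (kap_local un dg k_gt0 fiber_gt0 fiber_ge al_def al_le al_ge0 al_lt1
      y vU (subxx U) h1 h2 h3 h4 h5 h6 h7).
  apply: (le_trans (blocked_bound un dg k_gt0 om_gt0 a_ge1 c_ge1 step_le dom ler01
    (y := y) vU (subxx U) kl (ks_ge0 y) _)) => [t|].
    rewrite normc_real.
      exact: (kap_le un dg k_gt0 fiber_gt0 fiber_ge al_def al_le al_ge0 al_lt1).
    exact: (kap_ge0 un dg k_gt0 fiber_gt0 fiber_ge al_def al_le al_ge0 al_lt1).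
  rewrite mulr1 -mulrA ler_wpM2l // ler_wpM2r ?K0 // ler_weXn2l //.
  apply: leq_trans (subset_leq_card (subsetDl _ _)) _.
  by have := card_nbr un dg [set v]; rewrite cards1 muln1.
pose S := \sum_y 4 / 3 * (1 + bt) * nrm (be y) * ksy y * K y.
have Sle : nrm (\sum_y be y * T y) <= a ^+ (k * Delta) * S.
  apply: (le_trans (ler_normc_sum _ _ _)); rewrite /S mulr_sumr.
  apply: ler_sum => y _; rewrite Normc.normcM.
  apply: (@le_trans _ _ (nrm (be y) * (ksy y * (a ^+ (k * Delta) * K y)))).
    by rewrite ler_wpM2l ?normc_ge0.
  have -> : a ^+ (k * Delta) * (4 / 3 * (1 + bt) * nrm (be y) * ksy y * K y)
      = 4 / 3 * (1 + bt) * (nrm (be y) * (ksy y * (a ^+ (k * Delta) * K y))).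
    have reorder (u1 u2 u3 u4 u5 : R) :
      u1 * (u2 * u3 * u4 * u5) = u2 * (u3 * (u4 * (u1 * u5))) by ring.
    exact: reorder.
  have h : 0 <= a ^+ (k * Delta) * K y by rewrite mulr_ge0 ?K0 ?exprn_ge0.
  have h2 := mulr_ge0 (normc_ge0 (be y)) (mulr_ge0 (ks_ge0 y) h).
  by rewrite ler_peMl //; have := bt_ge1; lra.
(* If the mean were 1, then [1 <= th * a - bt < a - 1 <= 1], by [bt_ge1] and [a_le2]. *)
have contr : bt + a ^+ (k * Delta) * S <= th * a := free_contraction.
move: Sle; rewrite -T1 Normc.normc1 => Sle.
have tha : th * a < a by rewrite gtr_pMl // (lt_le_trans ltr01).
have b1 := bt_ge1; have a2 := a_le2.
have F : (1 : R) < 1 by clear T1; lra.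
by rewrite ltxx in F.
Qed.

End Recursion.

(** * Numerical consequences of the two size conditions *)

Section Numerics.
Variables (R : realType) (k Delta q s : nat).
Local Notation D := (Delta%:R : R).
Local Notation K := (k%:R : R).
Local Notation Q := (q%:R : R).
Local Notation S := (s%:R : R).

Hypothesis k_gt0 : (0 < k)%N.
Hypothesis Delta_gt0 : (0 < Delta)%N.
Hypothesis q_gt0 : (0 < q)%N.
Hypothesis bucket_large : 16 * Q ^+ 2 * D ^+ 3 * K ^+ 5 <= S ^+ k.
Hypothesis bucket_small : 64 * D ^+ 2 * K ^+ 4 * (Q * (4 * S / Q) ^+ k) <= 1.

Definition zero_radius : R := 1 / (16 * D ^+ 2 * K ^+ 5).
Definition degree_unit : R := (D ^+ 2 * K ^+ 4)^-1.

Let D1 : 1 <= D. Proof. by rewrite ler1n. Qed.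
Let K1 : 1 <= K. Proof. by rewrite ler1n. Qed.
Let Q1 : 1 <= Q. Proof. by rewrite ler1n. Qed.
Let KX1 n : 1 <= K ^+ n. Proof. exact: exprn_ege1. Qed.

Let Dp : 0 < D. Proof. by rewrite ltr0n. Qed.
Let Kp : 0 < K. Proof. by rewrite ltr0n. Qed.
Let DXp n : 0 < D ^+ n. Proof. exact: exprn_gt0. Qed.
Let KXp n : 0 < K ^+ n. Proof. exact: exprn_gt0. Qed.

(** The product [(1 + x) ^+ n * (1 - n%:R * x)] does not increase with [n] as long as its second
    factor is nonnegative, and it starts at 1. *)
Lemma expr1D_le (x h : R) n : 0 <= x -> n%:R * x <= h -> h < 1 ->
  (1 + x) ^+ n <= (1 - h)^-1.
Proof.
move=> x0 nx h1.
have key : (1 + x) ^+ n * (1 - n%:R * x) <= 1.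
  elim: n nx => [|n IH] nx; first by rewrite mul0r subr0 mulr1.
  have nx' : n%:R * x <= h by apply: le_trans nx; rewrite ler_wpM2r // ler_nat.
  apply: le_trans (IH nx'); rewrite exprSr -mulrA ler_wpM2l ?exprn_ge0 //.
    by rewrite addr_ge0.
  by rewrite -natr1; have : 0 <= n%:R :> R by []; nra.
have p0 : 0 <= (1 + x) ^+ n by rewrite exprn_ge0 // addr_ge0.
rewrite -[leRHS]mul1r ler_pdivlMr ?subr_gt0 //.
by apply: le_trans key; rewrite ler_wpM2l // lerB.
Qed.

Lemma degree_unit_gt0 : 0 < degree_unit.
Proof. by rewrite invr_gt0 mulr_gt0 //. Qed.

Lemma DD_degree_unit_le1 : D ^+ 2 * degree_unit <= 1.
Proof.
rewrite /degree_unit invfM mulrA divff ?mul1r ?invf_le1 ?gt_eqF //.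
Qed.

Lemma D_degree_unit_le1 : D * degree_unit <= 1.
Proof.
apply: le_trans DD_degree_unit_le1; rewrite ler_wpM2r ?(ltW degree_unit_gt0) //.
by rewrite expr2 ler_peMr // (le_trans ler01).
Qed.

Lemma degree_unit_le1 : degree_unit <= 1.
Proof. by apply: le_trans D_degree_unit_le1; rewrite ler_peMl // ltW // degree_unit_gt0. Qed.

Lemma k_zero_radius : k%:R * zero_radius = degree_unit / 16.
Proof.
have D0 : D != 0 by rewrite gt_eqF //.
have K0 : K != 0 by rewrite gt_eqF //.
by rewrite /zero_radius /degree_unit; field; rewrite D0 K0.
Qed.

Lemma zero_radius_gt0 : 0 < zero_radius.
Proof.
have u0 := degree_unit_gt0; have h := k_zero_radius.
have : 0 < K * zero_radius by rewrite h; lra.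
by rewrite pmulr_rgt0.
Qed.

Lemma zero_radius_le : zero_radius <= 16^-1.
Proof.
have h := k_zero_radius; have u1 := degree_unit_le1.
have : zero_radius <= K * zero_radius by rewrite ler_peMl // ltW // zero_radius_gt0.
by rewrite h; lra.
Qed.

Lemma s_gt1 : (1 < s)%N.
Proof.
rewrite ltnNge; apply/negP => s1.
have : S ^+ k <= 1 by rewrite exprn_ile1 // lern1.
apply/negP; rewrite -ltNge; apply: lt_le_trans bucket_large.
have : 1 <= Q ^+ 2 * D ^+ 3 * K ^+ 5 by rewrite !mulr_ege1.
by rewrite -!mulrA; lra.
Qed.

(** Otherwise every factor on the left of [bucket_small] would be at least 1. *)
Lemma s4_lt_q : (4 * s < q)%N.
Proof.
rewrite ltnNge; apply/negP => qs; have Q0 : 0 < Q by rewrite ltr0n.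
have h : 1 <= (4 * S / Q) ^+ k.
  by rewrite exprn_ege1 // ler_pdivlMr // mul1r -natrM ler_nat.
move: bucket_small; apply/negP; rewrite -ltNge.
have : 1 <= D ^+ 2 * K ^+ 4 * (Q * (4 * S / Q) ^+ k) by rewrite !mulr_ege1.
by rewrite -!mulrA; lra.
Qed.

Lemma Q_ge9 : 9 <= Q.
Proof. by have := s4_lt_q; have := s_gt1; rewrite (ler_nat R 9); lia. Qed.

Lemma sparse_le : Q * (4 * S / Q) ^+ k <= degree_unit / 64.
Proof.
have -> : degree_unit / 64 = 1 / (64 * D ^+ 2 * K ^+ 4).
  by rewrite /degree_unit; field; rewrite !gt_eqF.
by rewrite ler_pdivlMr ?mulr_gt0 // mulrC.
Qed.

(* Twice the bound [s ^ (1 - k)] on the probability that a hyperedge contained in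
   one bucket is monochromatic. *)
Definition avoid_rate : R := 2 / (s ^ k.-1)%:R.

Lemma avoid_rate_gt0 : 0 < avoid_rate.
Proof.
by rewrite divr_gt0 // ltr0n expn_gt0 (ltn_trans _ s_gt1).
Qed.

Lemma avoid_rate_le : Delta%:R * avoid_rate <= zero_radius / 18.
Proof.
have Q0 : 0 < Q by rewrite ltr0n.
have S0 : 0 < S by rewrite ltr0n (ltn_trans _ s_gt1).
have SX : S ^+ k = S * (s ^ k.-1)%:R by rewrite natrX -exprS prednK.
have T0 : 0 < (s ^ k.-1)%:R :> R by rewrite ltr0n expn_gt0 (ltn_trans _ s_gt1).
have h := bucket_large; rewrite SX in h.
set T := (s ^ k.-1)%:R in T0 h *.
have SQ : 4 * S <= Q by rewrite -natrM ler_nat ltnW // s4_lt_q.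
have Q9 := Q_ge9.
(* dividing [h] by [S <= Q / 4] leaves one factor [Q >= 9] to spare *)
have T1 : 4 * 16 * 9 * D ^+ 3 * K ^+ 5 <= T.
  set Y := D ^+ 3 * K ^+ 5; have Y0 : 0 <= Y by rewrite mulr_ge0 ?exprn_ge0.
  have h' : 16 * Q ^+ 2 * Y <= S * T by move: h; rewrite -!mulrA.
  have -> : 4 * 16 * 9 * D ^+ 3 * K ^+ 5 = 4 * (16 * (9 * Y)) by rewrite /Y; ring.
  rewrite -(ler_pM2l S0); apply: le_trans h'.
  have QQ : 36 * S <= Q ^+ 2 by rewrite expr2; nra.
  have h36 : 36 * S * Y <= Q ^+ 2 * Y by rewrite ler_wpM2r.
  have -> : S * (4 * (16 * (9 * Y))) = 16 * (36 * S * Y) by ring.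
  by rewrite -[leRHS]mulrA ler_wpM2l.
rewrite /avoid_rate mulrA ler_pdivrMr //.
have D0 : D != 0 by rewrite gt_eqF //.
have K0 : K != 0 by rewrite gt_eqF //.
apply: (@le_trans _ _ (zero_radius / 18 * (4 * 16 * 9 * D ^+ 3 * K ^+ 5))).
  have -> : zero_radius / 18 * (4 * 16 * 9 * D ^+ 3 * K ^+ 5) = 2 * D.
    by rewrite /zero_radius; field; rewrite D0 K0.
  by have := D1; lra.
by rewrite ler_wpM2l // divr_ge0 // ltW // zero_radius_gt0.
Qed.

Lemma kD_zero_radius_le : (k * Delta)%:R * zero_radius <= 16^-1.
Proof.
rewrite natrM [K * D]mulrC -mulrA k_zero_radius mulrA; have := D_degree_unit_le1; lra.
Qed.

Lemma avoid_rate_le_half : avoid_rate * (Delta * k)%:R <= 2^-1.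
Proof.
rewrite natrM mulrCA mulrA.
have h : D * avoid_rate * K <= zero_radius / 18 * K.
  by rewrite ler_wpM2r // avoid_rate_le.
have e : zero_radius / 18 * K = degree_unit / 288.
  by rewrite mulrAC [zero_radius * K]mulrC k_zero_radius; lra.
by move: h; rewrite e; have := degree_unit_le1; lra.
Qed.

(** The values taken for [a] and, just below, for [c]: close enough to 1 that their powers over a
    neighborhood stay bounded by constants, yet far enough from 1 to absorb the losses in [step_le]
    and [free_contraction]. *)
Definition vertex_cost : R := 1 + zero_radius.
Definition edge_cost : R := 1 + degree_unit / 4.

Lemma vertex_cost_pow_k : vertex_cost ^+ k <= 1 + degree_unit / 8.
Proof.
have u0 := degree_unit_gt0; have u1 := degree_unit_le1.
have h : (1 - degree_unit / 16)^-1 <= 1 + degree_unit / 8.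
  by rewrite -[leLHS]mul1r ler_pdivrMr; nra.
apply: le_trans h; apply: expr1D_le; rewrite ?k_zero_radius //; last by lra.
exact: ltW zero_radius_gt0.
Qed.

Lemma vertex_cost_pow_kD : vertex_cost ^+ (k * Delta) <= 16 / 15.
Proof.
have h : (1 - 16^-1 : R)^-1 <= 16 / 15 by rewrite -[leLHS]mul1r ler_pdivrMr; lra.
apply: le_trans h; apply: expr1D_le; [exact: ltW zero_radius_gt0|exact: kD_zero_radius_le|lra].
Qed.

Let degree_unit4_ge0 : 0 <= degree_unit / 4.
Proof. by rewrite divr_ge0 // ltW // degree_unit_gt0. Qed.

Lemma DDKK_degree_unit_le : (Delta ^ 2 * k ^ 2)%:R * (degree_unit / 4) <= 4^-1.
Proof.
rewrite natrM !natrX.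
have K0 : K != 0 by rewrite gt_eqF //.
have D0 : D != 0 by rewrite gt_eqF //.
have -> : D ^+ 2 * K ^+ 2 * (degree_unit / 4) = (K ^+ 2)^-1 / 4.
  by rewrite /degree_unit; field; rewrite D0 K0.
have : (K ^+ 2)^-1 <= 1 by rewrite invf_le1 //.
by lra.
Qed.

Lemma edge_cost_pow_D : edge_cost ^+ Delta <= 4 / 3.
Proof.
have h : (1 - 4^-1 : R)^-1 <= 4 / 3 by rewrite -[leLHS]mul1r ler_pdivrMr; lra.
apply: le_trans h; apply: expr1D_le => //; last by lra.
by have := D_degree_unit_le1; lra.
Qed.

Lemma edge_cost_pow_DK : edge_cost ^+ (Delta ^ 2 * k ^ 2) <= 4 / 3.
Proof.
have h : (1 - 4^-1 : R)^-1 <= 4 / 3 by rewrite -[leLHS]mul1r ler_pdivrMr; lra.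
apply: le_trans h; apply: expr1D_le => //; [exact: DDKK_degree_unit_le | lra].
Qed.

Lemma edge_cost_pow_near : edge_cost ^+ (Delta ^ 2 * k ^ 2 + Delta) <= 16 / 9.
Proof.
rewrite exprD (le_trans (ler_pM _ _ edge_cost_pow_DK edge_cost_pow_D)) //; last by lra.
  by rewrite exprn_ge0 // addr_ge0.
by rewrite exprn_ge0 // addr_ge0.
Qed.

(** The bucket of the distinguished color has no small [kap], but its factor [4 / Q] is smaller than
    that of the others by [S]. The gain [S ^+ k] is bounded below by [bucket_large]. *)
Lemma central_sparse_le : D * (4 / Q) ^+ k <= zero_radius / 100.
Proof.
have Q0 : 0 < Q by rewrite ltr0n.
have S0 : 0 < S by rewrite ltr0n (ltn_trans _ s_gt1).
have SX0 : 0 < S ^+ k by rewrite exprn_gt0.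
have -> : (4 / Q) ^+ k = (4 * S / Q) ^+ k / S ^+ k.
  by rewrite -expr_div_n; congr (_ ^+ _); field; rewrite !gt_eqF.
rewrite mulrA ler_pdivrMr //.
have w : (4 * S / Q) ^+ k <= 64^-1.
  have := sparse_le; have := degree_unit_le1.
  have : (4 * S / Q) ^+ k <= Q * (4 * S / Q) ^+ k.
    by rewrite ler_peMl // exprn_ge0 // divr_ge0 ?mulr_ge0.
  by lra.
have D0 : D != 0 by rewrite gt_eqF //.
have K0 : K != 0 by rewrite gt_eqF //.
apply: (@le_trans _ _ (zero_radius / 100 * (16 * Q ^+ 2 * D ^+ 3 * K ^+ 5))); last first.
  by rewrite ler_wpM2l // divr_ge0 // ltW // zero_radius_gt0.
have -> : zero_radius / 100 * (16 * Q ^+ 2 * D ^+ 3 * K ^+ 5) = 1 / 100 * (D * Q ^+ 2).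
  by rewrite /zero_radius; field; rewrite D0 K0.
have : D * (4 * S / Q) ^+ k <= D * 64^-1 by rewrite ler_wpM2l.
have Q9 : 9 <= Q ^+ 2 by rewrite expr2; have := Q_ge9; nra.
have : D * 9 <= D * Q ^+ 2 by rewrite ler_wpM2l.
by have := D1; lra.
Qed.

End Numerics.

(** * Even distribution of the colors over the buckets *)

Section Buckets.
Variables (q B : nat).
Hypothesis q_gt0 : (0 < q)%N.
Hypothesis B_gt0 : (0 < B)%N.
Local Notation s := ((q - 1) %/ B)%N.

(* [None] is the bucket of the distinguished color; the other [q - 1] colors are
   spread evenly over the buckets [Some b]. *)
Definition bucket (c : 'I_q) : option 'I_B :=
  if c == 0 :> nat then None else insub (c.-1 %% B)%N.

Lemma bucket_None c : (bucket c == None) = (c == 0 :> nat).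
Proof.
rewrite /bucket; case: (nat_of_ord c =P 0%N) => // _.
case: (@insubP _ _ 'I_B (c.-1 %% B)%N) => [//|/negP[]].
exact: ltn_pmod.
Qed.

Lemma bucket_Some c (b : 'I_B) :
  (bucket c == Some b) = (0 < c)%N && (c.-1 %% B == b)%N.
Proof.
rewrite /bucket lt0n; case: (nat_of_ord c =P 0%N) => //= _.
case: (@insubP _ _ 'I_B (c.-1 %% B)%N) => [b' _ <-|/negP[]].
  by apply/eqP/eqP => [[->]|/val_inj ->].
exact: ltn_pmod.
Qed.

Lemma fiber_None : #|fiber bucket None| = 1%N.
Proof.
apply/eqP/cards1P; exists (Ordinal q_gt0); apply/setP => c.
by rewrite !inE bucket_None -val_eqE.
Qed.

(** The colors [1 + j * B + b] with [j < s] all lie in this bucket. *)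
Lemma fiber_Some_ge (b : 'I_B) : (s <= #|fiber bucket (Some b)|)%N.
Proof.
have lt (j : 'I_s) : (1 + j * B + b < q)%N.
  have := leq_trunc_div (q - 1) B; have := ltn_ord j; have := ltn_ord b.
  move: (nat_of_ord j) (nat_of_ord b) => j' b' hb hj; nia.
rewrite -[s]card_ord -(card_imset (f := fun j => Ordinal (lt j))) => [|j1 j2 [/eqP]].
  apply/subset_leq_card/subsetP => c /imsetP[j _ ->].
  rewrite inE bucket_Some; apply/andP; split; first by [].
  have -> : (nat_of_ord (Ordinal (lt j))).-1 = (j * B + b)%N by [].
  by rewrite modnMDl modn_small.
by rewrite -!addnA eqn_add2l eqn_add2r eqn_pmul2r // => /eqP/val_inj.
Qed.

(** Within a bucket, a color [c] is determined by the quotient of [c.-1] by [B], which is at most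
    [s]. *)
Lemma fiber_Some_le (b : 'I_B) : (#|fiber bucket (Some b)| <= s.+1)%N.
Proof.
have lt (c : 'I_q) : (c.-1 %/ B < s.+1)%N.
  by rewrite ltnS leq_div2r //; have := ltn_ord c; lia.
rewrite -[s.+1]card_ord -(card_in_imset (f := fun c => Ordinal (lt c))) ?max_card //.
move=> c1 c2; rewrite !inE !bucket_Some => /andP[p1 /eqP m1] /andP[p2 /eqP m2] [d].
apply: val_inj => /=; rewrite -(prednK p1) -(prednK p2).
by rewrite (divn_eq c1.-1 B) (divn_eq c2.-1 B) d m1 m2.
Qed.

Lemma fiber_sum : (\sum_x #|fiber bucket x| = q)%N.
Proof.
rewrite -[RHS]card_ord -sum1_card (partition_big bucket xpredT) //=.
by apply: eq_bigr => x _; rewrite -sum1_card; apply: eq_bigl => c; rewrite inE.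
Qed.

End Buckets.

Lemma bad_monochromatic (V : finType) (q : nat) (e : {set V}) (sg : {ffun V -> 'I_q}) :
  e != set0 -> bad sg e = monochromatic sg e.
Proof.
case/set0Pn => u0 u0e; apply/existsP/forall_inP => [[c /forall_inP h] u ue|h].
  by apply/forall_inP => v ve; rewrite (eqP (h _ ue)) (eqP (h _ ve)).
by exists (sg u0); apply/forall_inP => u ue; exact: (forall_inP (h _ ue)).
Qed.

(** * Verification of the contraction conditions for [lambda] near the unit interval *)

Section Perturbation.
Variables (R : realType) (k Delta q B : nat) (lambda : R[i]) (lambda_c : R).
Local Notation nrm := (@Normc.normc R).
Local Notation s := ((q - 1) %/ B)%N.
Local Notation D := (Delta%:R : R).
Local Notation K := (k%:R : R).
Local Notation Q := (q%:R : R).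
Local Notation S := (s%:R : R).

Hypothesis k_gt0 : (0 < k)%N.
Hypothesis Delta_gt0 : (0 < Delta)%N.
Hypothesis q_gt0 : (0 < q)%N.
Hypothesis B_gt0 : (0 < B)%N.
Hypothesis bucket_large : 16 * Q ^+ 2 * D ^+ 3 * K ^+ 5 <= S ^+ k.
Hypothesis bucket_small : 64 * D ^+ 2 * K ^+ 4 * (Q * (4 * S / Q) ^+ k) <= 1.
Hypothesis lambda_c01 : 0 <= lambda_c <= 1.
Local Notation g := (zero_radius R k Delta).
Local Notation u := (degree_unit R k Delta).
Hypothesis lambda_near : nrm (lambda - lambda_c%:C) <= g.

Let g0 : 0 < g. Proof. exact: zero_radius_gt0. Qed.
Let g16 : g <= 16^-1. Proof. exact: zero_radius_le. Qed.
Let Q9 : 9 <= Q. Proof. exact: (Q_ge9 k_gt0 Delta_gt0 q_gt0 bucket_large). Qed.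
Let s2 : (1 < s)%N. Proof. exact: (s_gt1 k_gt0 Delta_gt0 q_gt0 bucket_large). Qed.
Let S2 : 2 <= S. Proof. by rewrite (ler_nat R 2). Qed.
Let Q0 : 0 < Q. Proof. by rewrite ltr0n. Qed.

(** The price [om] of pinning a vertex: a bound of the order of the probability of the bucket, with
    a margin that pays for the constants [4 / 3], [16 / 15] and [4 / 3] in [pinned_contraction]. *)
Definition vertex_factor (x : option 'I_B) : R :=
  if x == None then 4 / Q else 4 * S / Q.

Local Notation wc := (wcol (@bucket q B) None lambda).
Local Notation wt_all := (wtot (@bucket q B) None lambda).
Let W := nrm wt_all.
Let be x := wc x / wt_all.

Lemma wc_None : wc None = lambda.
Proof. by rewrite /wcol eqxx fiber_None // mulr1. Qed.

Lemma sum_wc_Some :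
  (\sum_(x | x != None :> option 'I_B) #|fiber (@bucket q B) x|)%N = (q - 1)%N.
Proof.
have := fiber_sum q B; rewrite (bigD1 None) //= fiber_None // => qE.
by apply/eqP; rewrite -(eqn_add2l 1) qE subnKC.
Qed.

Lemma wtot_E : wt_all = (q%:R - 1 + lambda_c)%:C + (lambda - lambda_c%:C).
Proof.
rewrite /wtot (bigD1 None) //= wc_None.
rewrite (eq_bigr (fun x => #|fiber (@bucket q B) x|%:R)) => [|x /negPf xn]; last first.
  by rewrite /wcol xn mul1r.
rewrite -natr_sum sum_wc_Some natrB // rmorphD rmorphB rmorph1 rmorph_nat.
by ring.
Qed.

Lemma W_ge : Q - 1 + lambda_c - g <= W.
Proof.
have /andP[l0 l1] := lambda_c01.
have q0 : 0 <= Q - 1 + lambda_c by have := Q9; lra.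
have := ger_normcB (q%:R - 1 + lambda_c)%:C (- (lambda - lambda_c%:C)).
rewrite opprK -wtot_E normc_real // normcN; apply: le_trans.
by rewrite lerB.
Qed.

(** As [Q] is at least 9, the difference [11 / 90 * Q] is at least [11 / 10], which exceeds
    [1 + g]. *)
Lemma W_geQ : 79 / 90 * Q <= W.
Proof.
have /andP[l0 l1] := lambda_c01.
by apply: le_trans W_ge; have := Q9; have := g16; lra.
Qed.

Let W0 : 0 < W.
Proof. by apply: lt_le_trans W_geQ; rewrite mulr_gt0 // divr_gt0. Qed.

Lemma nrm_lambda : nrm lambda <= lambda_c + g.
Proof.
have /andP[l0 l1] := lambda_c01.
rewrite -[lambda](subrK lambda_c%:C); apply: (le_trans (le_normcD _ _)).
by rewrite normc_real // addrC lerD2l.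
Qed.

Lemma nrm_be x : nrm (be x) = nrm (wc x) / W.
Proof. by rewrite Normc.normcM Normc.normcV. Qed.

Lemma nrm_wc_Some x : x != None -> nrm (wc x) = #|fiber (@bucket q B) x|%:R.
Proof. by move=> /negPf xn; rewrite /wcol xn mul1r normc_nat. Qed.

Lemma vertex_factor_gt0 x : 0 < vertex_factor x.
Proof.
have S0 : 0 < S by apply: lt_le_trans S2.
by rewrite /vertex_factor; case: ifP => _; rewrite divr_gt0 ?mulr_gt0.
Qed.

Lemma vertex_factor_le x : vertex_factor x <= 4 * S / Q.
Proof.
rewrite /vertex_factor; case: ifP => // _.
by rewrite ler_wpM2r ?invr_ge0 ?(ltW Q0) //; have := S2; lra.
Qed.

Let w := (4 * S / Q) ^+ k.
Let w0 : 0 <= w. Proof. by rewrite exprn_ge0 // divr_ge0 // mulr_ge0. Qed.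

Lemma vertex_factor_le1 x : vertex_factor x <= 1.
Proof.
apply: (le_trans (vertex_factor_le x)); rewrite ler_pdivrMr // mul1r -natrM ler_nat.
exact/ltnW/(s4_lt_q k_gt0 Delta_gt0 q_gt0 bucket_small).
Qed.

(** A bucket has at most [S + 1] colors, and [S + 1 <= 3 / 2 * S]. The constant [3 / 7] is chosen so
    that its product with 4 and with [79 / 90] from [W_geQ] is just above [3 / 2]. *)
Lemma be_le_factor x : nrm (be x) <= 3 / 7 * vertex_factor x.
Proof.
have /andP[l0 l1] := lambda_c01; have Wq := W_geQ; have Qn := Q0.
rewrite nrm_be ler_pdivrMr // /vertex_factor; case: (x =P None) => [->|/eqP xn].
  rewrite wc_None; apply: (le_trans nrm_lambda).
  apply: (@le_trans _ _ (3 / 7 * (4 / Q) * (79 / 90 * Q))); last first.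
    by rewrite ler_wpM2l // mulr_ge0 // divr_ge0 // ltW.
  have -> : 3 / 7 * (4 / Q) * (79 / 90 * Q) = 948 / 630 by field; rewrite gt_eqF.
  by have := g16; lra.
rewrite nrm_wc_Some //; apply: (@le_trans _ _ (S + 1)).
  by case: x xn => // b _; rewrite natr1 ler_nat fiber_Some_le.
apply: (@le_trans _ _ (3 / 7 * (4 * S / Q) * (79 / 90 * Q))); last first.
  by rewrite ler_wpM2l // mulr_ge0 // divr_ge0 // ?mulr_ge0 // ltW.
have -> : 3 / 7 * (4 * S / Q) * (79 / 90 * Q) = 948 / 630 * S by field; rewrite gt_eqF.
by have := S2; lra.
Qed.

Definition variation : R := 1 + g / 3.

Lemma sum_be_Some : \sum_(x | x != None) nrm (be x) = (Q - 1) / W.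
Proof.
rewrite (eq_bigr (fun x => #|fiber (@bucket q B) x|%:R / W)) => [|x xn]; last first.
  by rewrite nrm_be nrm_wc_Some.
by rewrite -mulr_suml -natr_sum sum_wc_Some natrB.
Qed.

(** Numerator and denominator differ from the real value [Q - 1 + lambda_c], which is at least 8, by
    at most [g] each, so the quotient exceeds 1 by only a fraction of [g]. *)
Lemma be_variation : \sum_x nrm (be x) <= variation.
Proof.
have /andP[l0 l1] := lambda_c01; have Wq := W_ge; have gn := g0; have Q9' := Q9.
have nl := nrm_lambda; have gs := g16.
rewrite (bigD1 None) //= sum_be_Some nrm_be wc_None -mulrDl ler_pdivrMr //.
apply: (@le_trans _ _ (variation * (Q - 1 + lambda_c - g))); last first.
  by rewrite ler_wpM2l // /variation; lra.
by rewrite /variation; nra.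
Qed.

Local Notation al := (avoid_rate R k s).
Local Notation ks := (blocking_rate Delta (None : option 'I_B) al).

Let al_small : D * al <= g / 18.
Proof. exact: (avoid_rate_le k_gt0 Delta_gt0 q_gt0 bucket_large). Qed.

Let al0 : 0 < al.
Proof. exact: (avoid_rate_gt0 k_gt0 Delta_gt0 q_gt0 bucket_large). Qed.

Lemma avoid_ks_le1 y : ks y <= 1.
Proof.
rewrite /blocking_rate; case: ifP => // _; have := al_small; have := g16; lra.
Qed.

Lemma sum_be_ks : \sum_x nrm (be x) * ks x <= 4^-1.
Proof.
have Qn := Q0; have Q9' := Q9; have gs := g16; have as' := al_small; have gn := g0.
rewrite (bigD1 None) //= {1}/blocking_rate eqxx mulr1.
rewrite (eq_bigr (fun x => nrm (be x) * (D * al))) => [|x /negPf xn]; last first.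
  by rewrite /blocking_rate xn.
rewrite -mulr_suml.
have h1 : nrm (be None) <= 12 / 63.
  apply: (le_trans (be_le_factor None)); rewrite /vertex_factor eqxx.
  by rewrite mulrA ler_pdivrMr //; lra.
have h2 : \sum_(x | x != None) nrm (be x) <= 2.
  apply: (@le_trans _ _ variation); last by rewrite /variation; lra.
  apply: le_trans be_variation; rewrite [leRHS](bigD1 None) //= lerDr.
  exact: normc_ge0.
have h3 : 0 <= \sum_(x | x != None) nrm (be x).
  by apply: sumr_ge0 => x _; exact: normc_ge0.
have h4 : 0 <= D * al by rewrite mulr_ge0 // ltW.
have := ler_pM h3 h4 h2 as'; lra.
Qed.

Local Notation a := (vertex_cost R k Delta).
Local Notation c := (edge_cost R k Delta).

Let sparse : Q * w <= u / 64.
Proof. exact: (sparse_le k_gt0 Delta_gt0 bucket_small). Qed.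
Let u0 : 0 < u. Proof. exact: degree_unit_gt0. Qed.
Let u1 : u <= 1. Proof. exact: degree_unit_le1. Qed.

Lemma sum_factor : \sum_x vertex_factor x ^+ k <= u / 64.
Proof.
apply: le_trans sparse; apply: (@le_trans _ _ (\sum_(x : option 'I_B) w)).
  apply: ler_sum => x _; apply: lerXn2r; rewrite ?nnegrE.
  - exact: ltW (vertex_factor_gt0 x).
  - by rewrite divr_ge0 // mulr_ge0.
  - exact: vertex_factor_le.
rewrite sumr_const card_option card_ord -[leLHS]mulr_natl ler_wpM2r // ler_nat.
(* Since [s] is positive, [B + 1 <= s * B + 1 <= q] bounds the number of buckets. *)
have Bs : (B <= s * B)%N by rewrite leq_pmull // ltnW.
by rewrite -[q](subnK q_gt0) addn1 ltnS (leq_trans Bs) // leq_trunc_div.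
Qed.

Lemma a_ge1 : 1 <= a. Proof. by rewrite /vertex_cost lerDl ltW. Qed.
Lemma a_le2 : a <= 2. Proof. by rewrite /vertex_cost; have := g16; lra. Qed.
Lemma c_ge1 : 1 <= c. Proof. by rewrite /edge_cost lerDl; have := u0; lra. Qed.

Lemma step_le :
  a ^+ k * (1 + (\sum_x vertex_factor x ^+ k) * c ^+ (Delta ^ 2 * k ^ 2)) <= c.
Proof.
have ak : a ^+ k <= 1 + u / 8 by exact: vertex_cost_pow_k.
have cD : c ^+ (Delta ^ 2 * k ^ 2) <= 4 / 3 by exact: edge_cost_pow_DK.
have P0 : 0 <= \sum_x vertex_factor x ^+ k.
  by apply: sumr_ge0 => x _; rewrite exprn_ge0 // ltW // vertex_factor_gt0.
have c0 : 0 <= c ^+ (Delta ^ 2 * k ^ 2) by rewrite exprn_ge0 // (le_trans ler01 c_ge1).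
have h := ler_pM P0 c0 sum_factor cD.
have a0 : 0 <= a ^+ k by rewrite exprn_ge0 // (le_trans ler01 a_ge1).
have h1 : 0 <= 1 + (\sum_x vertex_factor x ^+ k) * c ^+ (Delta ^ 2 * k ^ 2).
  by rewrite addr_ge0 // mulr_ge0.
apply: (@le_trans _ _ ((1 + u / 8) * (1 + u / 64 * (4 / 3)))).
  by rewrite ler_pM // lerD2l.
by rewrite /edge_cost; have := u0; have := u1; nra.
Qed.

(** The rate [th]. In [free_contraction] the gain [1 + g] of one vertex must cover the variation
    [1 + g / 3] and a remainder below [g / 15], which leaves room for a loss of [g / 4]. *)
Definition contraction : R := 1 - g / 4.

Lemma contraction_gt0 : 0 < contraction.
Proof. by rewrite /contraction; have := g16; lra. Qed.

Lemma contraction_lt1 : contraction < 1.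
Proof. by rewrite /contraction; have := g0; lra. Qed.

Let c0X n : 0 <= c ^+ n. Proof. by rewrite exprn_ge0 // (le_trans ler01 c_ge1). Qed.
Let a0X n : 0 <= a ^+ n. Proof. by rewrite exprn_ge0 // (le_trans ler01 a_ge1). Qed.

Lemma pinned_contraction x :
  4 / 3 * nrm (be x) * (a ^+ (k * Delta) * c ^+ Delta) <= contraction * vertex_factor x.
Proof.
have ak : a ^+ (k * Delta) <= 16 / 15 by exact: vertex_cost_pow_kD.
have cD : c ^+ Delta <= 4 / 3 by exact: edge_cost_pow_D.
have h := ler_pM (a0X _) (c0X _) ak cD.
have hb : 4 / 3 * nrm (be x) <= 4 / 3 * (3 / 7 * vertex_factor x).
  by rewrite ler_wpM2l ?divr_ge0 // be_le_factor.
have hb0 : 0 <= 4 / 3 * nrm (be x) by rewrite mulr_ge0 ?divr_ge0 ?normc_ge0.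
apply: (le_trans (ler_pM hb0 (mulr_ge0 (a0X _) (c0X _)) hb h)).
rewrite [contraction * _]mulrC.
have -> : 4 / 3 * (3 / 7 * vertex_factor x) * (16 / 15 * (4 / 3))
  = vertex_factor x * (256 / 315) by field.
rewrite ler_wpM2l ?(ltW (vertex_factor_gt0 x)) // /contraction.
by have := g16; lra.
Qed.

Lemma sum_ks_factor : \sum_y D * ks y * vertex_factor y ^+ k <= g / 50.
Proof.
have cen : D * (4 / Q) ^+ k <= g / 100.
  exact: (central_sparse_le k_gt0 Delta_gt0 q_gt0 bucket_large bucket_small).
rewrite (bigD1 None) //= {1}/blocking_rate eqxx mulr1 {1}/vertex_factor eqxx.
have gn := g0.
suff : \sum_(x | x != None) D * ks x * vertex_factor x ^+ k <= g / 100 by lra.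
apply: (@le_trans _ _ (\sum_(x : option 'I_B | x != None)
    D * (D * al) * vertex_factor x ^+ k)).
  by apply: ler_sum => x /negPf xn; rewrite /blocking_rate xn.
have D0 : 0 <= D by [].
have al0' := ltW al0.
rewrite -mulr_sumr; apply: (@le_trans _ _ (D * (D * al) * (u / 64))).
  rewrite ler_wpM2l ?(mulr_ge0 D0 (mulr_ge0 D0 al0')) //; apply: le_trans sum_factor.
  rewrite [leRHS](bigD1 None) //= lerDr exprn_ge0 // ltW //; exact: vertex_factor_gt0.
have Du : D * u <= 1 by exact: D_degree_unit_le1.
have -> : D * (D * al) * (u / 64) = (D * al) * (D * u) / 64 by ring.
have : D * al * (D * u) <= g / 18 * 1.
  by rewrite ler_pM ?al_small // mulr_ge0 // ltW.
by lra.
Qed.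

Lemma free_contraction :
  variation + a ^+ (k * Delta) * (\sum_y 4 / 3 * (1 + variation) * nrm (be y) * ks y
      * (D * vertex_factor y ^+ k.-1 * c ^+ (Delta ^ 2 * k ^ 2 + Delta)))
    <= contraction * a.
Proof.
have ak : a ^+ (k * Delta) <= 16 / 15 by exact: vertex_cost_pow_kD.
have cD : c ^+ (Delta ^ 2 * k ^ 2 + Delta) <= 16 / 9 by exact: edge_cost_pow_near.
have gn := g0; have gs := g16; have al0' := ltW al0.
have ks0 y : 0 <= ks y by rewrite /blocking_rate; case: ifP => // _; rewrite mulr_ge0.
set T := \sum_y _.
have T0 : 0 <= T.
  apply: sumr_ge0 => y _; have := ltW (vertex_factor_gt0 y) => f0.
  have v0 : 0 <= 1 + variation by rewrite /variation; lra.
  by rewrite !mulr_ge0 ?invr_ge0 ?normc_ge0 ?c0X ?exprn_ge0.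
(* Bounding [nrm (be y)] through [vertex_factor y] restores the exponent [k]; the factor 3 bounds
   [4 / 3 * (1 + variation)], and [3 / 7 * (16 / 9)] is below 1. *)
have Tle : T <= 3 * \sum_y D * ks y * vertex_factor y ^+ k.
  rewrite /T mulr_sumr; apply: ler_sum => y _.
  have f0 := ltW (vertex_factor_gt0 y).
  have b : nrm (be y) * c ^+ (Delta ^ 2 * k ^ 2 + Delta)
      <= 3 / 7 * vertex_factor y * (16 / 9).
    by apply: ler_pM => //; [exact: normc_ge0 | exact: be_le_factor].
  have X0 : 0 <= D * ks y * vertex_factor y ^+ k.-1 by rewrite !mulr_ge0 ?exprn_ge0.
  have fk : vertex_factor y ^+ k = vertex_factor y * vertex_factor y ^+ k.-1.
    by rewrite -exprS prednK.
  rewrite fk; move: b X0.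
  have v3 : 4 / 3 * (1 + variation) <= 3 by rewrite /variation; lra.
  have v0 : 0 <= 4 / 3 * (1 + variation) by rewrite /variation; lra.
  have nb := mulr_ge0 (normc_ge0 (be y)) (c0X (Delta ^ 2 * k ^ 2 + Delta)).
  move: (vertex_factor y) (vertex_factor y ^+ k.-1) (nrm (be y))
    (c ^+ (Delta ^ 2 * k ^ 2 + Delta)) (ks y) (4 / 3 * (1 + variation)) v3 v0 nb f0
    => f F n cc kk vv v3 v0 nb f0 b X0.
  have -> : vv * n * kk * (D * F * cc) = vv * (n * cc) * (D * kk * F) by ring.
  have -> : 3 * (D * kk * (f * F)) = 3 * f * (D * kk * F) by ring.
  rewrite ler_wpM2r //; apply: (@le_trans _ _ (3 * (3 / 7 * f * (16 / 9)))).
    by rewrite ler_pM.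
  by lra.
have Tg : T <= 3 * (g / 50).
  by apply: (le_trans Tle); rewrite ler_wpM2l // sum_ks_factor.
have : a ^+ (k * Delta) * T <= 16 / 15 * (3 * (g / 50)) by rewrite ler_pM.
by rewrite /variation /contraction /vertex_cost; nra.
Qed.

Lemma weight_sum_perturbed_neq0 (V : finType) (E : {set {set V}}) :
  uniform_of_degree k Delta E ->
  \sum_t weight (@bucket q B) None lambda E t != 0.
Proof.
move=> uE.
have al_half := avoid_rate_le_half k_gt0 Delta_gt0 q_gt0 bucket_large bucket_small.
have s_gt0 : (0 < s)%N by exact: ltnW.
have fib_gt0 x : (0 < #|fiber (@bucket q B) x|)%N.
  case: x => [b|]; last by rewrite fiber_None.
  by apply: leq_trans s_gt0 _; exact: fiber_Some_ge.
have fib_ge x : x != None -> (s <= #|fiber (@bucket q B) x|)%N.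
  by case: x => // b _; exact: fiber_Some_ge.
have wn0 : wt_all != 0.
  by apply: contraTneq W0 => h; rewrite /W h Normc.normc0 ltxx.
have v1 : 1 <= variation by rewrite /variation; have := g0; lra.
have al1 : al < 1.
  have as' := al_small; have gs := g16; apply: (@le_lt_trans _ _ (D * al)); last by lra.
  by rewrite ler_peMl ?ler1n // ltW.
have ald : 2 <= al * (s ^ k.-1)%:R.
  by rewrite /avoid_rate divfK // pnatr_eq0 -lt0n expn_gt0 s_gt0.
exact: (weight_sum_neq0 k_gt0 fib_gt0 fib_ge ald al_half (ltW al0) al1 wn0
  vertex_factor_gt0 vertex_factor_le1 a_ge1 a_le2 c_ge1 step_le avoid_ks_le1
  sum_be_ks v1 be_variation contraction_gt0 contraction_lt1 pinned_contraction free_contraction uE).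
Qed.

End Perturbation.

(** * Zero-freeness of the partition function of hypergraph colorings *)

Theorem theorem5p6 (R : realType) (V : finType) (E : {set {set V}})
    (k Delta q B : nat) (lambda : R[i]) (lambda_c : R)
    (hk : uniform E k)
    (hDelta : max_degree E = Delta)
    (Delta_gt0 : (0 < Delta)%N)
    (q_gt0 : (0 < q)%N)
    (B_gt0 : (0 < B)%N) :
  let s := ((q - 1) %/ B)%N in
  let gamma : R := 1 / (16 * Delta%:R ^+ 2 * k%:R ^+ 5) in
  608 * expR (1 : R) * q%:R ^+ 2 * Delta%:R ^+ 3 * k%:R ^+ 5 <= s%:R ^+ k ->
  16 * expR (1 : R) ^+ 2 * Delta%:R ^+ 2 * k%:R ^+ 4
    * (q%:R * (4 * s%:R / q%:R) ^+ k) <= 1 ->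
  0 <= lambda_c <= 1 ->
  `|lambda - lambda_c%:C| <= gamma%:C ->
  Zco E q lambda != 0.
Proof.
move=> s gamma large small lc01 near.
have deg v : (#|[set f in E | v \in f]| <= Delta)%N.
  by rewrite -hDelta; exact: (leq_bigmax_cond (F := degree E)).
(* For [k = 0] the only possible hyperedge is empty, and all degrees would vanish. *)
have k_gt0 : (0 < k)%N.
  rewrite lt0n; apply: contraTneq Delta_gt0 => k0.
  rewrite -hDelta /max_degree big1 // => v _; apply/eqP; rewrite cards_eq0.
  apply/eqP/setP => f; rewrite !inE; apply/negP => /andP[/hk].
  by rewrite k0 => /eqP; rewrite cards_eq0 => /eqP ->; rewrite inE.
have E0 f : f \in E -> f != set0 by move=> /hk fk; rewrite -cards_eq0 fk -lt0n.
(* The bound 2 on Euler's number turns [16 * e ^ 2] into 64 and is ample for replacing [608 * e] by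
   16. *)
have e2 : 2 <= expR (1 : R) by have := exp.expR_ge1Dx (1 : R); lra.
have large' : 16 * q%:R ^+ 2 * Delta%:R ^+ 3 * k%:R ^+ 5 <= s%:R ^+ k :> R.
  apply: le_trans large; rewrite -!mulrA ler_pM ?mulr_ge0 ?exprn_ge0 //; first by lra.
  by rewrite ler_peMl ?mulr_ge0 ?exprn_ge0 //; lra.
have small' : 64 * Delta%:R ^+ 2 * k%:R ^+ 4
    * (q%:R * (4 * s%:R / q%:R) ^+ k) <= 1 :> R.
  have reorder (y1 y2 y3 y4 : R) : y1 * y2 * y3 * y4 = y1 * (y2 * y3 * y4) by ring.
  apply: le_trans small; rewrite !reorder ler_wpM2r //.
    by rewrite !(mulr_ge0, exprn_ge0, invr_ge0).
  by rewrite expr2; nra.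
have near' : Normc.normc (lambda - lambda_c%:C) <= zero_radius R k Delta.
  by rewrite -lecR.
have uE : uniform_of_degree k Delta E by [].
have := weight_sum_perturbed_neq0 k_gt0 Delta_gt0 q_gt0 B_gt0 large' small'
  lc01 near' uE.
rewrite weight_sum ?fiber_None // /Zco.
congr (_ != _); apply: eq_big => [sg|sg _].
  by apply: eq_forallb_in => f /E0 f0; rewrite bad_monochromatic.
by congr (_ ^+ _); apply: eq_card => u; rewrite !inE bucket_None.
Qed.
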